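(* Let $(G,\Lambda)$ be a self-similar $k$-graph over a finitely aligned $k$-graph $\Lambda$. Then the following are equivalent. (1) The action $\theta:\mathcal{S}_{G,\Lambda}\curvearrowright\partial\Lambda$ is irreducible. (2) The groupoid $\mathcal{G}_{\mathrm{tight}}(\mathcal{S}_{G,\Lambda})$ is minimal. (3) $(G,\Lambda)$ is $G$-cofinal.
   Context: **$k$-graphs.** A $k$-graph is a countable small category $\Lambda$ with a functor $d:\Lambda\to\mathbb{N}^k$ (degree) with the unique factorisation property: if $d(\lambda)=m+n$ there are unique $\mu,\nu$ with $d(\mu)=m$, $d(\nu)=n$, $\lambda=\mu\nu$. $\Lambda^0=d^{-1}(0)$ is identified with the objects (vertices); $r,s$ are range and source, and $\mu\nu$ is defined iff $s(\mu)=r(\nu)$. $v\Lambda=\{\lambda:r(\lambda)=v\}$, $v\Lambda w=\{\lambda:r(\lambda)=v,s(\lambda)=w\}$. With $\vee$ the coordinatewise maximum, $\Lambda^{\min}(\mu,\nu)=\{(\alpha,\beta):\mu\alpha=\nu\beta,\ d(\mu\alpha)=d(\mu)\vee d(\nu)\}$. $\Lambda$ is finitely aligned if all $\Lambda^{\min}(\mu,\nu)$ are finite. $v\mathbf{FE}(\Lambda)$ is the collection of finite sets $X\subseteq v\Lambda\setminus\{v\}$ that are exhaustive: for every $\mu\in v\Lambda$ there is $\nu\in X$ with $\Lambda^{\min}(\mu,\nu)\ne\emptyset$. **Self-similar $k$-graph** $(G,\Lambda)=(G,\Lambda,\varphi)$: a finitely aligned $k$-graph $\Lambda$, a countable discrete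 group $G$ with identity $e_G$, an action of $G$ on $\Lambda$ by degree-preserving bijections commuting with $r$ and $s$, and a map $\varphi:G\times\Lambda\to G$ such that for all $g,h\in G$, $\mu,\nu\in\Lambda$ (with $s(\mu)=r(\nu)$ where $\mu\nu$ occurs), $v\in\Lambda^0$: $\varphi(gh,\mu)=\varphi(g,h\cdot\mu)\varphi(h,\mu)$; $g\cdot(\mu\nu)=(g\cdot\mu)(\varphi(g,\mu)\cdot\nu)$; $\varphi(g,\mu\nu)=\varphi(\varphi(g,\mu),\nu)$; $\varphi(g,v)=g$. **Boundary paths.** For $m\in(\mathbb{N}\cup\{\infty\})^k$, $\Omega_{k,m}=\{(p,q)\in\mathbb{N}^k\times\mathbb{N}^k:p\le q\le m\}$ is the $k$-graph with $r(p,q)=(p,p)$, $s(p,q)=(q,q)$, $d(p,q)=q-p$. A boundary path is a degree-preserving functor $x:\Omega_{k,m}\to\Lambda$ such that for all $p\in\mathbb{N}^k$, $p\le m$, and $X\in x(p)\mathbf{FE}(\Lambda)$ there is $\mu\in X$ with $x(p,p+d(\mu))=\mu$; $x(p)=x(p,p)$, $d(x)=m$, $r(x)=x(0)$. $\partial\Lambda$ is the set of boundary paths, $Z(\lambda)=\{\lambda y:y\in\partial\Lambda,r(y)=s(\lambda)\}$, and $\partial\Lambda$ has the locally compact Hausdorff topology with basis the sets $Z(\lambda)\setminus\bigcup_{i=1}^nZ(\lambda\nu_i)$ ($n\ge0$, $\nu_i\in s(\lambda)\Lambda$). $G$ acts on $\partial\Lambda$ by $(g\cdot x)(0,n)=g\cdot(x(0,n))$.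 **$G$-cofinal**: for every $v\in\Lambda^0$ and $x\in\partial\Lambda$ there are $n\in\mathbb{N}^k$, $n\le d(x)$, and $g\in G$ with $v\Lambda(g\cdot x(n))\ne\emptyset$. **$\mathcal{S}_{G,\Lambda}$**: elements are the finite sets $F$ of triples $(\mu,g,\nu)\in\Lambda\times G\times\Lambda$ with $s(\mu)=g\cdot s(\nu)$, such that any two distinct triples $(\mu,g,\nu),(\xi,h,\eta)\in F$ satisfy $\Lambda^{\min}(\mu,\xi)=\Lambda^{\min}(\nu,\eta)=\emptyset$. Multiplication: $EF=\bigcup_{(\mu,g,\nu)\in E,(\xi,h,\eta)\in F}\{(\mu(g\cdot\alpha),\varphi(g,\alpha)\varphi(h,h^{-1}\cdot\beta),\eta(h^{-1}\cdot\beta)):(\alpha,\beta)\in\Lambda^{\min}(\nu,\xi)\}$; $F^*=\{(\nu,g^{-1},\mu):(\mu,g,\nu)\in F\}$; zero is $\emptyset$. It is an inverse semigroup. **Action and groupoid.** The tight spectrum of $\mathcal{S}_{G,\Lambda}$ (the closure of the space of ultrafilters among the filters of idempotents not containing $0$) is identified with $\partial\Lambda$, $x$ corresponding to the filter of idempotents $E$ with $(x(0,n),e_G,x(0,n))\in E$ for some $n\le d(x)$. The standard action is $\theta_F:D^{F^*F}\to D^{FF^*}$, $\theta_F(\nu x)=\mu(g\cdot x)$ for $(\mu,g,\nu)\in F$, where $D^{F^*F}=\bigcup_{(\mu,g,\nu)\in F}Z(\nu)$ and $D^{FF^*}=\bigcup_{(\mu,g,\nu)\in F}Z(\mu)$.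 $\mathcal{G}_{\mathrm{tight}}(\mathcal{S}_{G,\Lambda})$ is its groupoid of germs $[F,x]$, $x\in D^{F^*F}$, with $[F,x]=[F',x']$ iff $x=x'$ and $FE=F'E$ for some idempotent $E$ with $x\in D^E$; unit space $\partial\Lambda$, $s([F,x])=x$, $r([F,x])=\theta_F(x)$. The action is irreducible if the only open sets $U\subseteq\partial\Lambda$ with $\theta_F(U\cap D^{F^*F})\subseteq U$ for all $F\in\mathcal{S}_{G,\Lambda}$ are $\emptyset$ and $\partial\Lambda$. A topological groupoid $\mathcal{G}$ is minimal if the only open $U\subseteq\mathcal{G}^{(0)}$ such that $s(\alpha)\in U\iff r(\alpha)\in U$ for all $\alpha\in\mathcal{G}$ are $\emptyset$ and $\mathcal{G}^{(0)}$. *)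

(* Defs.v *)
From HB Require Import structures.
From mathcomp Require Import all_boot all_order all_algebra.
From mathcomp Require Import mathcomp_extra boolp classical_sets functions cardinality.
From mathcomp Require Import topology.
From mathcomp Require Import zify.

Set Implicit Arguments.
Unset Strict Implicit.
Unset Printing Implicit Defensive.

Import GRing.Theory.
Local Open Scope classical_set_scope.
Local Open Scope ring_scope.

Notation Nk k := {ffun 'I_k -> nat}.
(* (N u {oo})^k, with [None] standing for infinity *)
Notation Nki k := {ffun 'I_k -> option nat}.

Definition lek k (m n : Nk k) : bool := [forall i, (m i <= n i)%N].
Definition joink k (m n : Nk k) : Nk k := [ffun i => maxn (m i) (n i)].
Definition subk k (m n : Nk k) : Nk k := [ffun i => (m i - n i)%N].
Definition leki k (m : Nk k) (n : Nki k) : bool :=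
  [forall i, if n i is Some b then (m i <= b)%N else true].
Definition addki k (m : Nk k) (n : Nki k) : Nki k :=
  [ffun i => omap (addn (m i)) (n i)].

Lemma lekk k (m : Nk k) : lek m m.
Proof. exact/forallP. Qed.

Lemma lek_trans k (n m p : Nk k) : lek m n -> lek n p -> lek m p.
Proof.
by move=> /forallP h1 /forallP h2; apply/forallP => i; apply: leq_trans (h2 i).
Qed.

Lemma leki_trans k (n m : Nk k) (p : Nki k) : lek m n -> leki n p -> leki m p.
Proof.
move=> /forallP h1 /forallP h2; apply/forallP => i; have := h2 i.
by case: (p i) => // b; apply: leq_trans.
Qed.

Lemma lek_addr k (m n : Nk k) : lek m (m + n).
Proof. by apply/forallP => i; rewrite ffunE leq_addr. Qed.

Lemma subkK k (m n : Nk k) : lek m n -> m + subk n m = n.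
Proof. by move=> /forallP h; apply/ffunP => i; rewrite !ffunE; apply: subnKC. Qed.

Lemma addkK k (m n : Nk k) : subk (m + n) m = n.
Proof. by apply/ffunP => i; rewrite !ffunE; apply: addKn. Qed.

(* Arrows-only presentation: an object is identified with its identity
   morphism, so [kr] and [ks] take values in the identity morphisms.  The
   composition [kcomp a b] is total but only meaningful when [ks a = kr b]. *)
Record kgraph (k : nat) := KGraph {
  kpath :> Type;
  kr : kpath -> kpath;
  ks : kpath -> kpath;
  kcomp : kpath -> kpath -> kpath;
  kd : kpath -> Nk k;
  kcountable : countable [set: kpath];
  kr_r : forall a, kr (kr a) = kr a;
  ks_r : forall a, ks (kr a) = kr a;
  kr_s : forall a, kr (ks a) = ks a;
  ks_s : forall a, ks (ks a) = ks a;
  kr_comp : forall a b, ks a = kr b -> kr (kcomp a b) = kr a;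
  ks_comp : forall a b, ks a = kr b -> ks (kcomp a b) = ks b;
  kcomp_r : forall a, kcomp (kr a) a = a;
  kcomp_s : forall a, kcomp a (ks a) = a;
  kcompA : forall a b c, ks a = kr b -> ks b = kr c ->
    kcomp a (kcomp b c) = kcomp (kcomp a b) c;
  kd_r : forall a, kd (kr a) = 0;
  kd_s : forall a, kd (ks a) = 0;
  kd_comp : forall a b, ks a = kr b -> kd (kcomp a b) = kd a + kd b;
  kfactor : forall (l : kpath) (m n : Nk k), kd l = m + n ->
    exists! p : kpath * kpath,
      [/\ ks p.1 = kr p.2, kd p.1 = m, kd p.2 = n & l = kcomp p.1 p.2]
}.

Section Omega.
Variables (k : nat) (m : Nki k).

Definition Omega_path := {pq : Nk k * Nk k | lek pq.1 pq.2 && leki pq.2 m}.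

Lemma Omega_proof (p q : Nk k) (pq : lek p q) (qm : leki q m) :
  lek (p, q).1 (p, q).2 && leki (p, q).2 m.
Proof. by rewrite /= pq qm. Qed.

Definition Omega_pair p q (pq : lek p q) (qm : leki q m) : Omega_path :=
  exist _ (p, q) (Omega_proof pq qm).

Lemma Omega_le (a : Omega_path) : lek (val a).1 (val a).2.
Proof. by case/andP: (valP a). Qed.

Lemma Omega_bd (a : Omega_path) : leki (val a).2 m.
Proof. by case/andP: (valP a). Qed.

Definition Omega_r (a : Omega_path) : Omega_path :=
  Omega_pair (lekk (val a).1) (leki_trans (Omega_le a) (Omega_bd a)).
Definition Omega_s (a : Omega_path) : Omega_path :=
  Omega_pair (lekk (val a).2) (Omega_bd a).
(* (p,q)(q,n) = (p,n); the value is [a] when the pairs do not compose *)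
Definition Omega_comp (a b : Omega_path) : Omega_path :=
  insubd a ((val a).1, (val b).2).
Definition Omega_d (a : Omega_path) : Nk k := subk (val a).2 (val a).1.

Lemma Omega_sr a b : Omega_s a = Omega_r b -> (val a).2 = (val b).1.
Proof. by move=> /(congr1 val) []. Qed.

Lemma Omega_srE (a b : Omega_path) :
  (val a).2 = (val b).1 -> Omega_s a = Omega_r b.
Proof. by move=> h; apply: val_inj; rewrite /= h. Qed.

Lemma val_Omega_comp a b : Omega_s a = Omega_r b ->
  val (Omega_comp a b) = ((val a).1, (val b).2).
Proof.
move=> /Omega_sr h; rewrite /Omega_comp val_insubd /= (Omega_bd b) andbT.
by rewrite (lek_trans (Omega_le a)) // h Omega_le.
Qed.

Lemma Omega_countable : countable [set: Omega_path].
Proof. exact: countableP. Qed.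

Lemma Omega_r_comp a b : Omega_s a = Omega_r b ->
  Omega_r (Omega_comp a b) = Omega_r a.
Proof. by move=> h; apply: val_inj; rewrite /= val_Omega_comp. Qed.

Lemma Omega_s_comp a b : Omega_s a = Omega_r b ->
  Omega_s (Omega_comp a b) = Omega_s b.
Proof. by move=> h; apply: val_inj; rewrite /= val_Omega_comp. Qed.

Lemma Omega_comp_r a : Omega_comp (Omega_r a) a = a.
Proof.
have h : Omega_s (Omega_r a) = Omega_r a by exact: Omega_srE.
by apply: val_inj; rewrite (val_Omega_comp h) /=; case: (val a).
Qed.

Lemma Omega_comp_s a : Omega_comp a (Omega_s a) = a.
Proof.
have h : Omega_s a = Omega_r (Omega_s a) by exact: Omega_srE.
by apply: val_inj; rewrite (val_Omega_comp h) /=; case: (val a).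
Qed.

Lemma Omega_compA a b c : Omega_s a = Omega_r b -> Omega_s b = Omega_r c ->
  Omega_comp a (Omega_comp b c) = Omega_comp (Omega_comp a b) c.
Proof.
move=> ab bc; apply: val_inj.
by rewrite !val_Omega_comp ?Omega_r_comp ?Omega_s_comp.
Qed.

Lemma subkk (n : Nk k) : subk n n = 0.
Proof. by apply/ffunP => i; rewrite !ffunE subnn. Qed.

Lemma Omega_d_comp a b : Omega_s a = Omega_r b ->
  Omega_d (Omega_comp a b) = Omega_d a + Omega_d b.
Proof.
move=> h; rewrite /Omega_d val_Omega_comp //=; have e := Omega_sr h.
have := Omega_le b; rewrite -e => h2.
rewrite -{1}(subkK h2) -{1}(subkK (Omega_le a)) -addrA addkK; congr (_ + _).
Qed.

Lemma Omega_factor (l : Omega_path) (n1 n2 : Nk k) : Omega_d l = n1 + n2 ->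
  exists! p : Omega_path * Omega_path,
    [/\ Omega_s p.1 = Omega_r p.2, Omega_d p.1 = n1, Omega_d p.2 = n2
      & l = Omega_comp p.1 p.2].
Proof.
rewrite /Omega_d => dl; have e := subkK (Omega_le l); rewrite dl addrA in e.
have h1 : lek (val l).1 ((val l).1 + n1) by exact: lek_addr.
have h2 : lek ((val l).1 + n1) (val l).2 by rewrite -e lek_addr.
have c : Omega_s (Omega_pair h1 (leki_trans h2 (Omega_bd l))) =
         Omega_r (Omega_pair h2 (Omega_bd l)) by exact: Omega_srE.
exists (Omega_pair h1 (leki_trans h2 (Omega_bd l)), Omega_pair h2 (Omega_bd l)).
split.
  split=> //=; first by rewrite addkK.
    by rewrite -[X in subk X]e addkK.
  by apply: val_inj; rewrite val_Omega_comp //=; case: (val l).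
move=> [a b] /= [ab da db lab].
have vl : val l = ((val a).1, (val b).2) by rewrite lab val_Omega_comp.
have ea : (val l).1 + n1 = (val a).2 by rewrite vl -da /= subkK ?Omega_le.
congr pair; apply: val_inj => /=; rewrite ea vl /=; first by case: (val a).
by rewrite (Omega_sr ab) -surjective_pairing.
Qed.

Definition Omega : kgraph k.
Proof.
refine (@KGraph k Omega_path Omega_r Omega_s Omega_comp Omega_d
  Omega_countable _ _ _ _ Omega_r_comp Omega_s_comp Omega_comp_r Omega_comp_s
  Omega_compA _ _ Omega_d_comp Omega_factor).
all: try by move=> a; apply: val_inj.
all: by move=> a; apply: subkk.
Defined.

End Omega.

Section KGraph.
Variables (k : nat) (L : kgraph k).
Implicit Types (a b l v : L) (X : set L).

(* the vertex set is the preimage of 0 under the degree functor *)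
Definition vertices : set L := [set v | kd v = 0].

Definition paths_to v : set L := [set l | kr l = v].

Definition Lmin a b : set (L * L) :=
  [set p | [/\ ks a = kr p.1, ks b = kr p.2, kcomp a p.1 = kcomp b p.2
             & kd (kcomp a p.1) = joink (kd a) (kd b)]].

Definition finitely_aligned := forall a b, finite_set (Lmin a b).

Lemma addkE (m n : Nk k) i : (m + n) i = (m i + n i)%N.
Proof. by rewrite ffunE. Qed.

Lemma addkI (m n p : Nk k) : m + n = m + p -> n = p.
Proof. by move=> h; rewrite -(addkK m n) h addkK. Qed.

Lemma kcomp_inj (a b a' b' : L) : ks a = kr b -> ks a' = kr b' -> kd a = kd a' ->
  kcomp a b = kcomp a' b' -> a = a' /\ b = b'.
Proof.
move=> ab ab' da e.
have db : kd b = kd b'.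
  apply: (@addkI (kd a)); rewrite -kd_comp // e kd_comp //; congr (_ + _); done.
have [p [_ u]] := kfactor (kd_comp ab).
have := u (a, b) (And4 ab erefl erefl erefl).
have /= := u (a', b') (And4 ab' (esym da) (esym db) e).
by move=> -> [-> ->].
Qed.

Lemma lek_joinl (m n : Nk k) : lek m (joink m n).
Proof. by apply/forallP => i; rewrite ffunE leq_maxl. Qed.
Lemma lek_joinr (m n : Nk k) : lek n (joink m n).
Proof. by apply/forallP => i; rewrite ffunE leq_maxr. Qed.
Lemma join_lek (m n p : Nk k) : lek m p -> lek n p -> lek (joink m n) p.
Proof. by move=> /forallP a /forallP b; apply/forallP => i; rewrite ffunE geq_max a b. Qed.

Lemma prefix_ex (l : L) m : lek m (kd l) ->
  exists a b, [/\ ks a = kr b, kd a = m & l = kcomp a b].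
Proof.
move=> h; have [[a b] [[/= ab da db e] _]] := kfactor (esym (subkK h)).
by exists a, b.
Qed.

Lemma common_ext (m n a b : L) : ks m = kr a -> ks n = kr b ->
  kcomp m a = kcomp n b ->
  exists al be c, [/\ Lmin m n (al, be), ks al = kr c, ks be = kr c,
     a = kcomp al c & b = kcomp be c].
Proof.
move=> ma nb e.
have hm : lek (kd m) (kd (kcomp m a)) by rewrite kd_comp // lek_addr.
have hn : lek (kd n) (kd (kcomp m a)) by rewrite e kd_comp // lek_addr.
have [t [c [tc dt ec]]] := prefix_ex (join_lek hm hn).
have hm' : lek (kd m) (kd t) by rewrite dt lek_joinl.
have hn' : lek (kd n) (kd t) by rewrite dt lek_joinr.
have [m' [al [mal dm tal]]] := prefix_ex hm'.
have [n' [be [nbe dn tbe]]] := prefix_ex hn'.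
have alc : ks al = kr c by rewrite -tc tal ks_comp.
have bec : ks be = kr c by rewrite -tc tbe ks_comp.
have [] := @kcomp_inj m a m' (kcomp al c) ma _ _ _.
- by rewrite kr_comp.
- by rewrite dm.
- by rewrite ec tal kcompA.
move=> em ea.
have [] := @kcomp_inj n b n' (kcomp be c) nb _ _ _.
- by rewrite kr_comp.
- by rewrite dn.
- by rewrite -e ec tbe kcompA.
move=> en eb.
exists al, be, c; split => //.
split => /=; rewrite ?em ?en //; first by rewrite -tal tbe.
by rewrite -tal dt em en.
Qed.

Lemma Lmin_common (m n a b : L) : ks m = kr a -> ks n = kr b ->
  kcomp m a = kcomp n b -> Lmin m n !=set0.
Proof.
by move=> ma nb e; have [al [be [_ [H _ _ _ _]]]] := common_ext ma nb e; exists (al, be).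
Qed.

Lemma Lmin_prefix (m n a b : L) : ks m = kr a -> ks n = kr b ->
  Lmin (kcomp m a) (kcomp n b) !=set0 -> Lmin m n !=set0.
Proof.
move=> ma nb [[al be] [/= h1 h2 h3 _]].
rewrite ks_comp // in h1; rewrite ks_comp // in h2.
by apply: (@Lmin_common _ _ (kcomp a al) (kcomp b be)); rewrite ?kr_comp ?kcompA.
Qed.

Lemma Lmin_cancel (m a b : L) : ks m = kr a -> ks m = kr b ->
  Lmin (kcomp m a) (kcomp m b) !=set0 -> Lmin a b !=set0.
Proof.
move=> ma mb [[al be] [/= h1 h2 h3 _]].
rewrite ks_comp // in h1; rewrite ks_comp // in h2.
rewrite -!kcompA // in h3.
have ma' : ks m = kr (kcomp a al) by rewrite kr_comp.
have mb' : ks m = kr (kcomp b be) by rewrite kr_comp.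
by have [_ e] := kcomp_inj ma' mb' erefl h3; apply: Lmin_common e.
Qed.

Lemma Lmin_mul (m a b : L) : ks m = kr a -> ks m = kr b ->
  Lmin a b !=set0 -> Lmin (kcomp m a) (kcomp m b) !=set0.
Proof.
move=> ma mb [[al be] [/= h1 h2 h3 _]].
by apply: (@Lmin_common _ _ al be); rewrite ?ks_comp // -!kcompA // h3.
Qed.

Lemma Lmin_eq (a b : L) : kd a = kd b -> Lmin a b !=set0 -> a = b.
Proof.
by move=> d [[al be] [/= h1 h2 h3 _]]; have [] := kcomp_inj h1 h2 d h3.
Qed.

Definition FE v : set (set L) :=
  [set X | [/\ finite_set X, X `<=` paths_to v `\ v
    & forall a, paths_to v a -> exists2 b, X b & Lmin a b !=set0]].

Record boundary_path := BoundaryPath {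
  bd : Nki k;
  bfun :> Omega bd -> L;
  bfun_r : forall c, bfun (kr c) = kr (bfun c);
  bfun_s : forall c, bfun (ks c) = ks (bfun c);
  bfun_comp : forall c c', ks c = kr c' ->
    bfun (kcomp c c') = kcomp (bfun c) (bfun c');
  bfun_d : forall c, kd (bfun c) = kd c;
  bfun_boundary : forall (p : Nk k) (hp : leki p bd) X,
    FE (bfun (Omega_pair (lekk p) hp)) X ->
    exists2 l, X l & exists hl : leki (p + kd l) bd,
      bfun (Omega_pair (lek_addr p (kd l)) hl) = l
}.

(* [bseg x pq qx] is x(p,q), and [bvert x px] is the vertex x(p) = x(p,p) *)
Definition bseg (x : boundary_path) p q (pq : lek p q) (qx : leki q (bd x)) : L :=
  x (Omega_pair pq qx).
Definition bvert (x : boundary_path) p (px : leki p (bd x)) : L :=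
  bseg (lekk p) px.

Lemma lek0 (p : Nk k) : lek 0 p.
Proof. by apply/forallP => i; rewrite ffunE. Qed.

Lemma leki0 (p : Nki k) : leki 0 p.
Proof. by apply/forallP => i; rewrite ffunE; case: (p i). Qed.

Definition brange (x : boundary_path) : L := bvert (leki0 (bd x)).

Lemma lek_add2l (p q r : Nk k) : lek p q -> lek (r + p) (r + q).
Proof.
by move=> /forallP h; apply/forallP => i; rewrite !ffunE leq_add2l.
Qed.

Lemma leki_addki (r q : Nk k) (m : Nki k) :
  leki q m -> leki (r + q) (addki r m).
Proof.
move=> /forallP h; apply/forallP => i; have := h i; rewrite !ffunE.
by case: (m i) => //= b; rewrite leq_add2l.
Qed.

(* [is_concat l y x] means x = l y: the degree of x is d(l) + d(y), x starts
   with l, and the rest of x is y *)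
Definition is_concat l (y x : boundary_path) :=
  [/\ brange y = ks l,
      bd x = addki (kd l) (bd y),
      (exists hl : leki (kd l) (bd x), bseg (lek0 (kd l)) hl = l)
    & forall p q (pq : lek p q) (qy : leki q (bd y))
        (qx : leki (kd l + q) (bd x)),
        bseg (lek_add2l (kd l) pq) qx = bseg pq qy].

Definition Zset l : set boundary_path :=
  [set x | exists2 y, brange y = ks l & is_concat l y x].

Lemma bsegI (x y : boundary_path) : bd x = bd y ->
  (forall n (hx : leki n (bd x)) (hy : leki n (bd y)),
     bseg (lek0 n) hx = bseg (lek0 n) hy) -> x = y.
Proof.
move: x y => [m f fr fs fc fd fb] [m' f' fr' fs' fc' fd' fb'] /= e.
subst m' => H.
have {}H : f = f'.
  apply/funext => c; pose p := (val c).1; pose q := (val c).2.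
  have pq : lek p q := Omega_le c. have qm : leki q m := Omega_bd c.
  have -> : c = Omega_pair pq qm by apply: val_inj; rewrite /= -surjective_pairing.
  have pm := leki_trans pq qm.
  pose a : Omega m := Omega_pair (lek0 p) pm.
  pose b : Omega m := Omega_pair pq qm.
  have ab : ks a = kr b by exact: Omega_srE.
  have E : kcomp a b = Omega_pair (lek0 q) qm.
    by apply: val_inj; rewrite /= val_Omega_comp.
  have := H q qm qm; rewrite /bseg /= (eq_irrelevance qm) -E fc // fc' // => K.
  have [] := @kcomp_inj _ _ _ _ _ _ _ K.
  - by rewrite -fs -fr ab.
  - by rewrite -fs' -fr' ab.
  - by rewrite fd fd'.
  by [].
subst f'; congr BoundaryPath; exact: Prop_irrelevance.
Qed.
Lemma kd0_vertex (a : L) : kd a = 0 -> kr a = a.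
Proof.
move=> h; have [] // := @kcomp_inj (kr a) a a (ks a).
- by rewrite ks_r.
- by rewrite kr_s.
- by rewrite kd_r h.
- by rewrite kcomp_r kcomp_s.
Qed.

Lemma path_family (m : Nki k) (I : forall q, leki q m -> L) :
  (forall q h, kd (I q h) = q) ->
  (forall p q hp hq, lek p q -> exists2 b, ks (I p hp) = kr b & I q hq = kcomp (I p hp) b) ->
  exists f : Omega m -> L,
   [/\ (forall c, f (kr c) = kr (f c)), (forall c, f (ks c) = ks (f c)),
     (forall c c', ks c = kr c' -> f (kcomp c c') = kcomp (f c) (f c')),
     (forall c, kd (f c) = kd c) &
     (forall q h, f (Omega_pair (lek0 q) h) = I q h)].
Proof.
move=> dI eI.
have ch (c : Omega m) : exists b, ks (I _ (leki_trans (Omega_le c) (Omega_bd c))) = kr b /\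
  I _ (Omega_bd c) = kcomp (I _ (leki_trans (Omega_le c) (Omega_bd c))) b.
  by have [b] := eI _ _ (leki_trans (Omega_le c) (Omega_bd c)) (Omega_bd c) (Omega_le c); exists b.
have [f Hf] := choice ch.
have uf (c : Omega m) b p q hp hq : (val c).1 = p -> (val c).2 = q -> ks (I p hp) = kr b -> I q hq = kcomp (I p hp) b -> f c = b.
  move=> e1 e2; move: hp hq; rewrite -e1 -e2 => hp hq.
  rewrite (eq_irrelevance hp (leki_trans (Omega_le c) (Omega_bd c))).
  rewrite (eq_irrelevance hq (Omega_bd c)) => h1 h2.
  have [h3 h4] := Hf c.
  by have [] // := kcomp_inj h3 h1 erefl _; rewrite -h4 -h2.
have fs0 (c : Omega m) : ks (f c) = ks (I _ (Omega_bd c)).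
  by have [h1 ->] := Hf c; rewrite ks_comp.
have fr0 (c : Omega m) : kr (f c) = ks (I _ (leki_trans (Omega_le c) (Omega_bd c))).
  by have [-> _] := Hf c.
exists f; split.
- move=> c; rewrite fr0; set h := leki_trans _ _.
  by apply: (@uf (kr c) _ (val c).1 (val c).1 h h); rewrite ?kr_s ?kcomp_s.
- move=> c; rewrite fs0; set h := Omega_bd c.
  by apply: (@uf (ks c) _ (val c).2 (val c).2 h h); rewrite ?kr_s ?kcomp_s.
- move=> c c' cc.
  have [h1 h2] := Hf c. have [h3 h4] := Hf c'.
  have e := Omega_sr cc.
  have v : val (kcomp c c') = _ := val_Omega_comp cc.
  have E : ks (f c) = kr (f c').
    rewrite fs0 fr0. move: (Omega_bd c) (leki_trans _ _).
    by rewrite e => u w; rewrite (eq_irrelevance u w).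
  apply: (@uf _ _ _ _ (leki_trans (Omega_le c) (Omega_bd c)) (Omega_bd c')).
  + by rewrite v.
  + by rewrite v.
  + by rewrite kr_comp.
  + rewrite kcompA // -h2 h4. congr kcomp.
    move: (Omega_bd c) (leki_trans (Omega_le c') _).
    by rewrite e => u w; rewrite (eq_irrelevance u w).
- move=> c; have [h1 h2] := Hf c.
  have := dI _ (Omega_bd c); rewrite h2 kd_comp // dI => h.
  rewrite /= /Omega_d -[X in subk X]h addkK //.
- move=> q h; have h0 : leki 0 m := leki0 m.
  have e0 : ks (I 0 h0) = I 0 h0.
    by rewrite -(kd0_vertex (dI 0 h0)) ks_r.
  have [b h1 h2] := eI 0 q h0 h (lek0 q).
  have K : kr (I q h) = I 0 h0 by rewrite h2 kr_comp // (kd0_vertex (dI 0 h0)).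
  apply: (@uf _ _ 0 q h0 h) => //; first by rewrite e0.
  by rewrite -{1}K kcomp_r.
Qed.

Lemma bseg_split (y : boundary_path) p q r (pq : lek p q) (qr : lek q r) (pr : lek p r)
  (qm : leki q (bd y)) (rm : leki r (bd y)) :
  ks (bseg pq qm) = kr (bseg qr rm) /\ bseg pr rm = kcomp (bseg pq qm) (bseg qr rm).
Proof.
pose a : Omega (bd y) := Omega_pair pq qm.
pose b : Omega (bd y) := Omega_pair qr rm.
have ab : ks a = kr b by exact: Omega_srE.
split; first by rewrite /bseg -bfun_s -bfun_r ab.
rewrite /bseg -(bfun_comp ab); congr (@bfun _ _).
by apply: val_inj; rewrite /= val_Omega_comp.
Qed.

Lemma bseg_d (y : boundary_path) p q (pq : lek p q) (qm : leki q (bd y)) :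
  kd (bseg pq qm) = subk q p.
Proof. by rewrite /bseg bfun_d. Qed.

Lemma bseg_r (y : boundary_path) p q (pq : lek p q) (qm : leki q (bd y)) (pm : leki p (bd y)) :
  kr (bseg pq qm) = bvert pm.
Proof. by rewrite /bseg -bfun_r; congr (@bfun _ _); apply: val_inj. Qed.

Lemma bseg_s (y : boundary_path) p q (pq : lek p q) (qm : leki q (bd y)) :
  ks (bseg pq qm) = bvert qm.
Proof. by rewrite /bseg -bfun_s; congr (@bfun _ _); apply: val_inj. Qed.

Lemma bsegE (y : boundary_path) p q p' q' (pq : lek p q) (qm : leki q (bd y)) 
   (pq' : lek p' q') (qm' : leki q' (bd y)) : p = p' -> q = q' -> bseg pq qm = bseg pq' qm'.
Proof. by move=> e1 e2; rewrite /bseg; congr (@bfun _ _); apply: val_inj; rewrite /= e1 e2. Qed.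

Lemma FE_ext (v : L) X a : finitely_aligned -> kr a = v -> FE v X ->
  (exists2 l, X l & exists2 b, ks l = kr b & a = kcomp l b) \/
  FE (ks a) [set z | exists2 l, X l & exists w, Lmin a l (z, w)].
Proof.
move=> fa av [finX Xv exh].
case: (pselect (exists2 l, X l & exists w, Lmin a l (ks a, w))).
  move=> [l Xl [w [/= h1 h2 h3 _]]]; left; exists l => //; exists w => //.
  by rewrite -h3 kcomp_s.
move=> no; right; split.
- apply: (@sub_finite_set _ _ (\bigcup_(l in X) (fst @` Lmin a l))).
    by move=> z [l Xl [w H]]; exists l => //; exists (z, w).
  by apply: bigcup_finite => // l _; apply: finite_image.
- move=> z [l Xl [w H]]; split; first by case: H => /= ->.
  by move=> /= e; apply: no; exists l => //; exists w; rewrite -e.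
- move=> t /= at_; have [|l Xl [[g d] [/= h1 h2 h3 _]]] := exh (kcomp a t).
    by rewrite /paths_to /= kr_comp.
  rewrite ks_comp // in h1.
  rewrite -kcompA // in h3.
  have [|al [be [c [H h5 h6 h7 h8]]]] := common_ext _ h2 h3; first by rewrite kr_comp.
  exists al; first by exists l => //; exists be.
  have atg : ks a = kr al by case: H.
  have [x [y [c' [H' _ _ _ _]]]] := common_ext h1 h5 h7.
  by exists (x, y).
Qed.

Lemma concat_ex (l : L) y : finitely_aligned -> brange y = ks l -> exists x, is_concat l y x.
Proof.
move=> fa ry; pose m := addki (kd l) (bd y).
pose t (q : Nk k) := subk (joink q (kd l)) (kd l).
have tm q : leki q m -> leki (t q) (bd y).
  move=> /forallP h; apply/forallP => i; have := h i; rewrite /m !(addkE, ffunE).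
  case: (bd y i) => //= b; lia.
have tt p q : lek p q -> lek (t p) (t q).
  move=> /forallP h; apply/forallP => i; have := h i; rewrite !(addkE, ffunE); lia.
pose Y q h := kcomp l (bseg (lek0 (t q)) (tm q h)).
have lY q h : ks l = kr (bseg (lek0 (t q)) (tm q h)).
  by rewrite (bseg_r _ _ (leki0 _)) -ry.
have sub0 (n : Nk k) : subk n 0 = n by apply/ffunP => i; rewrite !ffunE subn0.
have dY q h : kd (Y q h) = joink q (kd l).
  rewrite kd_comp // bseg_d sub0; apply/ffunP => i; rewrite ?/t !(addkE, ffunE); lia.
have exI (qh : {q | leki q m}) : exists a, exists c, [/\ ks a = kr c, kd a = val qh & Y _ (valP qh) = kcomp a c].
  by have := @prefix_ex (Y _ (valP qh)) (val qh); rewrite dY; apply; apply: lek_joinl.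
have [I0 HI0] := choice exI.
pose I q h := I0 (exist _ q h).
have HI q h : exists c, [/\ ks (I q h) = kr c, kd (I q h) = q & Y q h = kcomp (I q h) c].
  have [c [h1 h2 h3]] := HI0 (exist _ q h); exists c; split => //.
  by rewrite -h3; congr Y; apply: eq_irrelevance.
have [f [fr fs fc fd f0]] : exists f : Omega m -> L,
   [/\ (forall c, f (kr c) = kr (f c)), (forall c, f (ks c) = ks (f c)),
     (forall c c', ks c = kr c' -> f (kcomp c c') = kcomp (f c) (f c')),
     (forall c, kd (f c) = kd c) &
     (forall q h, f (Omega_pair (lek0 q) h) = I q h)].
  apply: path_family; first by move=> q h; case: (HI q h) => c [].
  move=> p q hp hq pq.
  have [c [h1 h2 h3]] := HI p hp. have [c' [h1' h2' h3']] := HI q hq.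
  have [|a [b [ab da Iq]]] := @prefix_ex (I q hq) p; first by rewrite h2'.
  have [k1 k2] := bseg_split (lek0 (t p)) (tt _ _ pq) (lek0 (t q)) (tm p hp) (tm q hq).
  have E : Y q hq = kcomp (Y p hp) (bseg (tt _ _ pq) (tm q hq)).
    by rewrite /Y k2 kcompA.
  have bc : ks b = kr c' by rewrite -h1' Iq ks_comp.
  have sY : ks (Y p hp) = kr (bseg (tt _ _ pq) (tm q hq)) by rewrite /Y ks_comp.
  have cs : ks c = kr (bseg (tt _ _ pq) (tm q hq)) by rewrite -sY h3 ks_comp.
  rewrite h3' h3 Iq -!kcompA // in E.
  have [| | |e _] := kcomp_inj _ _ _ E; rewrite ?kr_comp ?h2 ?da //.
  by exists b; rewrite -e.
have IY q (h : leki (kd l + q) m) (hq : leki q (bd y)) : I _ h = kcomp l (bseg (lek0 q) hq).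
  have [c [h1 h2 h3]] := HI _ h.
  have e : t (kd l + q) = q.
    apply/ffunP => i; rewrite /t !(addkE, ffunE); move: (kd l i) (q i) => u v. lia.
  have e2 : Y _ h = kcomp l (bseg (lek0 q) hq).
    by rewrite /Y; congr (kcomp _ _); apply: bsegE.
  have cY : ks (kcomp l (bseg (lek0 q) hq)) = kr (ks (kcomp l (bseg (lek0 q) hq))).
    by rewrite kr_s.
  have dd : kd (I _ h) = kd (kcomp l (bseg (lek0 q) hq)).
    rewrite h2 -e2 dY; apply/ffunP => i; rewrite !(addkE, ffunE).
    move: (kd l i) (q i) => u v; lia.
  have ee : kcomp (I _ h) c = kcomp (kcomp l (bseg (lek0 q) hq)) (ks (kcomp l (bseg (lek0 q) hq))).
    by rewrite -h3 kcomp_s.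
  by have [] := kcomp_inj h1 cY dd ee.
have lm : leki (kd l) m by have := leki_addki (kd l) (leki0 (bd y)); rewrite addr0.
have If : I _ lm = l.
  have Ie p q (hp : leki p m) (hq : leki q m) : p = q -> I p hp = I q hq.
    by move=> e; move: hp; rewrite e => hp; congr I; apply: eq_irrelevance.
  have h' : leki (kd l + 0) m by rewrite addr0.
  rewrite (Ie _ _ lm h') ?addr0 // (IY _ h' (leki0 _)).
  rewrite -[RHS]kcomp_s -ry; congr (kcomp _ _); exact: bsegE.
have seg p q (pq : lek p q) (qy : leki q (bd y)) (qx : leki (kd l + q) m) :
  f (Omega_pair (lek_add2l (kd l) pq) qx) = bseg pq qy.
  have py := leki_trans pq qy.
  have px : leki (kd l + p) m by apply: leki_trans qx; apply: lek_add2l.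
  pose a : Omega m := Omega_pair (lek0 (kd l + p)) px.
  pose b : Omega m := Omega_pair (lek_add2l (kd l) pq) qx.
  have ab : ks a = kr b by exact: Omega_srE.
  have E : kcomp a b = Omega_pair (lek0 (kd l + q)) qx.
    by apply: val_inj; rewrite /= val_Omega_comp.
  have := fc _ _ ab; rewrite E !f0.
  have [k1 k2] := bseg_split (lek0 p) pq (lek0 q) py qy.
  rewrite (IY q qx qy) k2 kcompA //; last by rewrite (bseg_r _ _ (leki0 _)) -ry.
  rewrite -(IY p px py) => K.
  have [| | |//] := kcomp_inj _ _ _ K.
  - by rewrite (IY p px py) ks_comp // (bseg_r _ _ (leki0 _)) -ry.
  - by rewrite -f0 -fs -fr ab.
  - by [].
have bdry : forall (p : Nk k) (hp : leki p m) X,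
    FE (f (Omega_pair (lekk p) hp)) X ->
    exists2 l, X l & exists hl : leki (p + kd l) m,
      f (Omega_pair (lek_addr p (kd l)) hl) = l.
  move=> p hp X HX.
  pose n := joink p (kd l).
  have pn : lek p n by exact: lek_joinl.
  have nl : n = kd l + t p by apply/ffunP => i; rewrite ?/t !(addkE, ffunE); lia.
  have nm : leki n m by rewrite nl; apply: leki_addki; exact: (tm _ hp).
  pose A : Omega m := Omega_pair pn nm.
  have fA : kr (f A) = f (Omega_pair (lekk p) hp).
    by rewrite -fr; congr f; apply: val_inj.
  have K (c : Omega m) a b : ks a = kr b -> f c = kcomp a b -> (val c).1 = p -> 
    exists hl : leki (p + kd a) m, f (Omega_pair (lek_addr p (kd a)) hl) = a.
    move=> ab e cp; have d := fd c; rewrite e kd_comp // in d.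
    have c2 : (val c).2 = p + kd a + kd b.
      by rewrite -addrA d -cp subkK // Omega_le.
    have h2 : lek (p + kd a) (val c).2 by rewrite c2 lek_addr.
    have h3 : leki (p + kd a) m by apply: leki_trans h2 (Omega_bd c).
    exists h3.
    pose u : Omega m := Omega_pair (lek_addr p (kd a)) h3.
    pose w : Omega m := Omega_pair h2 (Omega_bd c).
    have uw : ks u = kr w by exact: Omega_srE.
    have E : kcomp u w = c.
      by apply: val_inj; rewrite /= val_Omega_comp //= -cp -surjective_pairing.
    rewrite -E fc // in e.
    have [| | |//] := kcomp_inj _ _ _ e => //.
      by rewrite -fs -fr uw.
    by rewrite fd /= /Omega_d /= addkK.
  have [[a Xa [b ab fe]]|FX] := FE_ext fa fA HX.
    by exists a => //; apply: K ab fe _.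
  have ny : leki (t p) (bd y) by exact: (tm _ hp).
  have vy : ks (f A) = y (Omega_pair (lekk (t p)) ny).
    have q1 : leki (kd l + t p) m by rewrite -nl.
    rewrite -fs -[RHS]/(bseg (lekk (t p)) ny) -(seg _ _ (lekk _) ny q1).
    by congr f; apply: val_inj; rewrite /= -nl.
  rewrite vy in FX.
  have [z [a Xa [w Hw]] [hz ez]] := bfun_boundary FX.
  exists a => //.
  have nz : leki (n + kd z) m.
    by rewrite nl -addrA; apply: leki_addki.
  have nz' : lek n (n + kd z) := lek_addr _ _.
  pose B : Omega m := Omega_pair nz' nz.
  have AB : ks A = kr B by exact: Omega_srE.
  have fB : f B = z.
    have q1 : leki (kd l + (t p + kd z)) m by rewrite addrA -nl.
    rewrite -[RHS]ez -[RHS]/(bseg (lek_addr _ _) hz) -(seg _ _ _ _ q1).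
    by congr f; apply: val_inj; rewrite /= addrA -nl.
  case: Hw => /= h1 h2 h3 _.
  apply: (K (kcomp A B) a w h2); first by rewrite fc // fB.
  by rewrite /= val_Omega_comp.
exists (@BoundaryPath m f fr fs fc fd bdry); split => //.
- by exists lm; rewrite /bseg /= f0.
Qed.

Lemma concat_uniq (l : L) y x x' : is_concat l y x -> is_concat l y x' -> x = x'.
Proof.
move=> [h1 h2 [k1 h3] h4] [h1' h2' [k1' h3'] h4'].
have bb : bd x = bd x' by rewrite h2 h2'.
apply: bsegI => // n hx hx'.
(* extend to n join d(l) *)
pose N := joink n (kd l).
pose q := subk N (kd l).
have nN : lek n N := lek_joinl n (kd l).
have NE : N = kd l + q by rewrite /q subkK // lek_joinr.
have lN : lek (kd l) (kd l + q) by exact: lek_addr.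
have qy : leki q (bd y).
  apply/forallP => i; have := forallP hx i; rewrite h2 !(addkE, ffunE).
  case: (bd y i) => //= b; move: (kd l i) (n i) => u v; lia.
have Nx : leki (kd l + q) (bd x) by rewrite h2 leki_addki.
have Nx' : leki (kd l + q) (bd x') by rewrite -bb.
have full (z : boundary_path) (zl : leki (kd l) (bd z)) (zN : leki (kd l + q) (bd z)) :
   bseg (lek0 (kd l)) zl = l ->
   bseg (lek_add2l (kd l) (lek0 q)) zN = bseg (lek0 q) qy ->
   bseg (lek0 (kd l + q)) zN = kcomp l (bseg (lek0 q) qy).
  move=> e1 e2.
  have [_ ->] := bseg_split (lek0 (kd l)) lN (lek0 _) zl zN.
  rewrite e1 -e2; congr (kcomp _ _); apply: bsegE => //; by rewrite addr0.
have nN' : lek n (kd l + q) by rewrite -NE.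
have [c1 e1] := bseg_split (lek0 n) nN' (lek0 _) hx Nx.
have [c2 e2] := bseg_split (lek0 n) nN' (lek0 _) hx' Nx'.
rewrite (full x k1) // in e1. rewrite (full x' k1') // in e2.
have K : kcomp (bseg (lek0 n) hx) (bseg nN' Nx) = kcomp (bseg (lek0 n) hx') (bseg nN' Nx').
  by rewrite -e1 -e2.
by have [] := kcomp_inj c1 c2 _ K; rewrite ?bseg_d.
Qed.

(* x = l y determines y *)
Lemma concat_inj (l : L) y y' x : is_concat l y x -> is_concat l y' x -> y = y'.
Proof.
move=> [h1 h2 _ h4] [h1' h2' _ h4'].
have bb : bd y = bd y'.
  apply/ffunP => i; have := congr1 (fun m : Nki k => m i) h2; rewrite h2' !ffunE.
  case: (bd y i) (bd y' i) => [b|] [b'|] //= [] ; move: (kd l i) => u e; congr Some; lia.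
apply: bsegI => // n hx hx'.
have qx : leki (kd l + n) (bd x) by rewrite h2 leki_addki.
by rewrite -(h4 _ _ _ _ qx) (h4' _ _ _ hx').
Qed.

Lemma concat_Lmin (a b : L) y y' x : is_concat a y x -> is_concat b y' x -> Lmin a b !=set0.
Proof.
move=> [_ ex [ha ea] _] [_ ex' [hb eb] _].
pose n := joink (kd a) (kd b).
have hn : leki n (bd x).
  apply/forallP => i; have := forallP ha i; have := forallP hb i; rewrite !ffunE.
  by case: (bd x i) => // c h1 h2; rewrite geq_max h1 h2.
have [c1 e1] := bseg_split (lek0 _) (lek_joinl (kd a) (kd b)) (lek0 n) ha hn.
have [c2 e2] := bseg_split (lek0 _) (lek_joinr (kd a) (kd b)) (lek0 n) hb hn.
rewrite ea in c1 e1; rewrite eb in c2 e2; rewrite e1 in e2.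
by have [u [v [w [H _ _ _ _]]]] := common_ext c1 c2 e2; exists (u, v).
Qed.

Definition basic_open : set (set boundary_path) :=
  [set A | exists l (N : set L),
    [/\ finite_set N, N `<=` paths_to (ks l)
      & A = Zset l `\` \bigcup_(n in N) Zset (kcomp l n)]].

End KGraph.
Arguments vertices {k} L.

HB.instance Definition _ k (L : kgraph k) := gen_eqMixin (boundary_path L).
HB.instance Definition _ k (L : kgraph k) := gen_choiceMixin (boundary_path L).
(* When L is finitely aligned, [basic_open] is closed under finite
   intersections up to unions, hence is a base of the topology it generates. *)
HB.instance Definition _ k (L : kgraph k) :=
  isSubBaseTopological.Build (boundary_path L) (@basic_open k L) id.

Record self_similar (k : nat) (L : kgraph k) (G : groupType) := SelfSimilar {
  ss_aligned : finitely_aligned L;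
  ss_countable : countable [set: G];
  ssact : G -> L -> L;
  sscoc : G -> L -> G;
  ssact1 : forall a, ssact 1%g a = a;
  ssactM : forall g h a, ssact (g * h)%g a = ssact g (ssact h a);
  ssact_d : forall g a, kd (ssact g a) = kd a;
  ssact_r : forall g a, kr (ssact g a) = ssact g (kr a);
  ssact_s : forall g a, ks (ssact g a) = ssact g (ks a);
  sscocM : forall g h a, sscoc (g * h)%g a = (sscoc g (ssact h a) * sscoc h a)%g;
  (* the right-hand side of g . (a b) = (g . a)(phi(g, a) . b) is defined *)
  ssact_composable : forall g a b, ks a = kr b ->
    ks (ssact g a) = kr (ssact (sscoc g a) b);
  ssact_comp : forall g a b, ks a = kr b ->
    ssact g (kcomp a b) = kcomp (ssact g a) (ssact (sscoc g a) b);
  sscoc_comp : forall g a b, ks a = kr b ->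
    sscoc g (kcomp a b) = sscoc (sscoc g a) b;
  sscoc_vertex : forall g v, vertices L v -> sscoc g v = g
}.

Section SelfSimilar.
Variables (k : nat) (L : kgraph k) (G : groupType) (S : self_similar L G).
Local Notation act := (ssact S).
Local Notation phi := (sscoc S).
Implicit Types (x y z : boundary_path L).

Definition G_cofinal :=
  forall (v : L) x, vertices L v ->
    exists (n : Nk k) (hn : leki n (bd x)) (g : G),
      exists l : L, kr l = v /\ ks l = act g (bvert hn).

(* [is_bact g x y] means y = g . x, the boundary path with
   y(0,n) = g . x(0,n) for all n <= d(x) *)
Definition is_bact (g : G) x y :=
  bd y = bd x /\
  forall n (hx : leki n (bd x)) (hy : leki n (bd y)),
    bseg (lek0 n) hy = act g (bseg (lek0 n) hx).

Lemma actK g : cancel (act g) (act g^-1).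
Proof. by move=> a; rewrite -ssactM mulVg ssact1. Qed.
Lemma actVK g : cancel (act g^-1) (act g).
Proof. by move=> a; rewrite -ssactM mulgV ssact1. Qed.

Lemma Lmin_act g (a b : L) : Lmin a b !=set0 -> Lmin (ssact S g a) (ssact S g b) !=set0.
Proof.
move=> [[c d] [/= h1 h2 h3 _]].
have e : kcomp (ssact S g a) (ssact S (sscoc S g a) c) = kcomp (ssact S g b) (ssact S (sscoc S g b) d).
  by rewrite -!ssact_comp // h3.
have [u [v [w [H _ _ _ _]]]] := common_ext (ssact_composable S g h1) (ssact_composable S g h2) e.
by exists (u, v).
Qed.

Lemma bact_uniq g x y y' : is_bact g x y -> is_bact g x y' -> y = y'.
Proof.
move=> [e h] [e' h']; apply: bsegI; first by rewrite e e'.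
move=> n hy hy'; have hx : leki n (bd x) by rewrite -e.
by rewrite (h n hx) (h' n hx).
Qed.

Lemma FE_act g (v : L) X : FE (ssact S g v) X -> FE v [set z | X (ssact S g z)].
Proof.
move=> [fX sX eX]; split.
- apply: (@sub_finite_set _ _ (ssact S g^-1%g @` X)); last exact: finite_image.
  by move=> z Xz; exists (ssact S g z) => //; rewrite actK.
- move=> z /= /sX [/= h1 h2]; split => /=.
    by apply: (can_inj (actK g)); rewrite -ssact_r.
  by move=> e; apply: h2; rewrite e.
- move=> a /= av; have [|b Xb ne] := eX (ssact S g a).
    by rewrite /paths_to /= ssact_r av.
  exists (ssact S g^-1%g b); first by rewrite /= actVK.
  by have := Lmin_act g^-1%g ne; rewrite actK.
Qed.

Lemma bact_ex g x : exists y, is_bact g x y.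
Proof.
pose m := bd x.
pose I q (h : leki q m) := ssact S g (bseg (lek0 q) h).
have [f [fr fs fc fd f0]] : exists f : Omega m -> L,
   [/\ (forall c, f (kr c) = kr (f c)), (forall c, f (ks c) = ks (f c)),
     (forall c c', ks c = kr c' -> f (kcomp c c') = kcomp (f c) (f c')),
     (forall c, kd (f c) = kd c) &
     (forall q h, f (Omega_pair (lek0 q) h) = I q h)].
  apply: path_family.
    move=> q h; rewrite /I ssact_d bseg_d; apply/ffunP => i; rewrite !ffunE; exact: subn0.
  move=> p q hp hq pq.
  have [c e] := bseg_split (lek0 p) pq (lek0 q) hp hq.
  exists (ssact S (sscoc S g (bseg (lek0 p) hp)) (bseg pq hq)).
    exact: ssact_composable.
  by rewrite /I e ssact_comp.
have seg p q (pq : lek p q) (hp : leki p m) (hq : leki q m) :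
  f (Omega_pair pq hq) = ssact S (sscoc S g (bseg (lek0 p) hp)) (bseg pq hq).
  pose a : Omega m := Omega_pair (lek0 p) hp.
  pose b : Omega m := Omega_pair pq hq.
  have ab : ks a = kr b by exact: Omega_srE.
  have E : kcomp a b = Omega_pair (lek0 q) hq.
    by apply: val_inj; rewrite /= val_Omega_comp.
  have [c e] := bseg_split (lek0 p) pq (lek0 q) hp hq.
  have := fc _ _ ab; rewrite E !f0 /I e ssact_comp // => K.
  have c2 := ssact_composable S g c.
  have c3 : ks (ssact S g (bseg (lek0 p) hp)) = kr (f b).
    by rewrite -[LHS]/(ks (I p hp)) -f0 -fs -fr ab.
  by have [] := kcomp_inj c2 c3 erefl K.
have bdry : forall (p : Nk k) (hp : leki p m) X,
    FE (f (Omega_pair (lekk p) hp)) X ->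
    exists2 l, X l & exists hl : leki (p + kd l) m,
      f (Omega_pair (lek_addr p (kd l)) hl) = l.
  move=> p hp X; rewrite seg => /FE_act FX.
  have [l /= Xl [hl e]] := bfun_boundary FX.
  exists (ssact S (sscoc S g (bseg (lek0 p) hp)) l) => //.
  have hl' : leki (p + kd (ssact S (sscoc S g (bseg (lek0 p) hp)) l)) m by rewrite ssact_d.
  exists hl'; rewrite (seg _ _ _ hp); congr (ssact _ _ _).
  by rewrite -[RHS]e; apply: bsegE; rewrite ?ssact_d.
exists (@BoundaryPath k L m f fr fs fc fd bdry); split => //.
move=> n hx hy; rewrite /bseg /= (f0 _ hy) /I; congr (ssact _ _ _).
exact: bsegE.
Qed.

Definition triple : Type := L * G * L.

Record SGL := MkSGL {
  sgl_set :> set triple;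
  sgl_finite : finite_set sgl_set;
  sgl_source : forall t, sgl_set t -> ks t.1.1 = act t.1.2 (ks t.2);
  sgl_orth : forall t t', sgl_set t -> sgl_set t' -> t <> t' ->
    Lmin t.1.1 t'.1.1 = set0 /\ Lmin t.2 t'.2 = set0
}.

Definition mul_set (E F : set triple) : set triple :=
  [set t | exists mu g nu xi h eta alpha beta,
    [/\ E (mu, g, nu), F (xi, h, eta), Lmin nu xi (alpha, beta)
      & t = (kcomp mu (act g alpha),
             (phi g alpha * phi h (act h^-1 beta))%g,
             kcomp eta (act h^-1 beta))]].

Lemma Lmin_neq0 (a b : L) : ~ (Lmin a b !=set0) -> Lmin a b = set0.
Proof. by move=> h; apply/seteqP; split => // p Hp; apply: h; exists p. Qed.

Lemma sgl_eql (F : SGL) t t' : (F : set triple) t -> (F : set triple) t' ->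
  Lmin t.1.1 t'.1.1 !=set0 -> t = t'.
Proof.
move=> Ft Ft'; apply: contraPP => ne; have [-> _] := sgl_orth Ft Ft' ne.
by case.
Qed.

Lemma sgl_eqr (F : SGL) t t' : (F : set triple) t -> (F : set triple) t' ->
  Lmin t.2 t'.2 !=set0 -> t = t'.
Proof.
move=> Ft Ft'; apply: contraPP => ne; have [_ ->] := sgl_orth Ft Ft' ne.
by case.
Qed.

Lemma mul_finite (E F : SGL) : finite_set (mul_set E F).
Proof.
pose prd (e f : triple) (p : L * L) : triple :=
  (kcomp e.1.1 (act e.1.2 p.1),
   (phi e.1.2 p.1 * phi f.1.2 (act (f.1.2)^-1 p.2))%g,
   kcomp f.2 (act (f.1.2)^-1 p.2)).
apply: (@sub_finite_set _ _ (\bigcup_(e in (E : set triple))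
  \bigcup_(f in (F : set triple)) (prd e f @` Lmin e.2 f.1.1))).
  move=> t [mu [g [nu [xi [h [eta [al [be [Ee Ff H ->]]]]]]]]].
  by exists (mu, g, nu) => //; exists (xi, h, eta) => //; exists (al, be).
apply: bigcup_finite => [|e _]; first exact: sgl_finite.
apply: bigcup_finite => [|f _]; first exact: sgl_finite.
by apply: finite_image; apply: (ss_aligned S).
Qed.

Lemma actV_vertex (F : SGL) xi h eta beta : (F : set triple) (xi, h, eta) ->
  ks xi = kr beta -> ks eta = kr (act h^-1 beta).
Proof. by move=> /sgl_source /= e b; rewrite ssact_r -b e actK. Qed.

Lemma act_vertex (F : SGL) mu g nu alpha : (F : set triple) (mu, g, nu) ->
  ks nu = kr alpha -> ks mu = kr (act g alpha).
Proof. by move=> /sgl_source /= e a; rewrite ssact_r -a. Qed.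

Lemma phi_act_s g (a : L) : act (phi g a) (ks a) = act g (ks a).
Proof.
have := ssact_composable S g (esym (kr_s a)).
by rewrite ssact_r kr_s ssact_s => ->.
Qed.

Lemma mul_source (E F : SGL) t : mul_set E F t -> ks t.1.1 = act t.1.2 (ks t.2).
Proof.
move=> [mu [g [nu [xi [h [eta [al [be [Ee Ff [/= h1 h2 h3 _] ->]]]]]]]]] /=.
rewrite (ks_comp (act_vertex Ee h1)) (ks_comp (actV_vertex Ff h2)) ssactM.
rewrite phi_act_s !ssact_s actVK.
have -> : ks be = ks al by rewrite -(ks_comp h1) h3 ks_comp.
by rewrite phi_act_s.
Qed.

Lemma mul_orth (E F : SGL) t t' : mul_set E F t -> mul_set E F t' -> t <> t' ->
  Lmin t.1.1 t'.1.1 = set0 /\ Lmin t.2 t'.2 = set0.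
Proof.
move=> [mu [g [nu [xi [h [eta [al [be [Ee Ff H ->]]]]]]]]].
move=> [mu' [g' [nu' [xi' [h' [eta' [al' [be' [Ee' Ff' H' ->]]]]]]]]] ne.
have [/= a1 a2 a3 a4] := H; have [/= b1 b2 b3 b4] := H'.
have fin : Lmin (kcomp nu al) (kcomp nu' al') !=set0 ->
    (mu, g, nu) = (mu', g', nu') -> (xi, h, eta) = (xi', h', eta') -> False.
  move=> N [? ? ?] [? ? ?]; subst.
  have E0 := Lmin_eq (etrans a4 (esym b4)) N.
  have [_ ea] := kcomp_inj a1 b1 erefl E0.
  have [_ eb] := kcomp_inj a2 b2 erefl (etrans (esym a3) (etrans E0 b3)).
  by apply: ne; rewrite ea eb.
have onl : Lmin (kcomp nu al) (kcomp nu' al') !=set0 -> False.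
  move=> N; apply: (fin N).
    by apply: (sgl_eqr Ee Ee'); apply: Lmin_prefix N.
  by apply: (sgl_eql Ff Ff'); rewrite a3 b3 in N; apply: Lmin_prefix N.
split; apply: Lmin_neq0 => /= N; apply: onl.
  have e := sgl_eql Ee Ee' (Lmin_prefix (act_vertex Ee a1) (act_vertex Ee' b1) N).
  case: e => *; subst; apply: Lmin_mul => //.
  have := Lmin_cancel (act_vertex Ee a1) (act_vertex Ee b1) N.
  by move=> /(Lmin_act g'^-1%g); rewrite !actK.
have e := sgl_eqr Ff Ff' (Lmin_prefix (actV_vertex Ff a2) (actV_vertex Ff' b2) N).
case: e => *; subst; rewrite a3 b3; apply: Lmin_mul => //.
have := Lmin_cancel (actV_vertex Ff a2) (actV_vertex Ff b2) N.
by move=> /(Lmin_act h'); rewrite !actVK.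
Qed.

Definition sgl_mul (E F : SGL) : SGL :=
  MkSGL (mul_finite E F) (@mul_source E F) (@mul_orth E F).
Definition sgl_idempotent (E : SGL) := sgl_mul E E = E.

(* D^{F^*F}, where F^*F consists of the triples (nu, 1, nu) for (mu, g, nu) in
   F; for an idempotent E this is D^E, since then E = E^*E *)
Definition sgl_dom (F : SGL) : set (boundary_path L) :=
  \bigcup_(t in (F : set triple)) Zset t.2.

(* the graph of theta_F : nu y |-> mu (g . y) for (mu, g, nu) in F *)
Definition theta_graph (F : SGL) x z :=
  exists mu g nu y w, [/\ (F : set triple) (mu, g, nu),
    is_concat nu y x, is_bact g y w & is_concat mu w z].

Lemma theta_graph_ex (F : SGL) x : sgl_dom F x ->
  exists z, theta_graph F x z.
Proof.
have fa := ss_aligned S; move=> [[[mu g] nu] Ft [y ry cy]].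
have [w [ew hw]] := bact_ex g y.
have := sgl_source Ft => /= sr.
have rw : brange w = ks mu.
  rewrite sr -ry (_ : brange w = bseg (lek0 0) (leki0 (bd w))); last exact: bsegE.
  rewrite (hw 0 (leki0 _)); congr (ssact _ _ _); exact: bsegE.
by have [z cz] := concat_ex fa rw; exists z, mu, g, nu, y, w; split.
Qed.

Lemma theta_graph_uniq (F : SGL) x z z' : theta_graph F x z -> theta_graph F x z' -> z = z'.
Proof.
move=> [mu [g [nu [y [w [Ft c1 b1 d1]]]]]] [mu' [g' [nu' [y' [w' [Ft' c1' b1' d1']]]]]].
have E : (mu, g, nu) = (mu', g', nu').
  apply: contrapT => ne; have [_ /= h] := sgl_orth Ft Ft' ne.
  by have := concat_Lmin c1 c1'; rewrite h => -[].
case: E => *; subst.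
move: (concat_inj c1 c1') => ?; subst.
move: (bact_uniq b1 b1') => ?; subst.
exact: concat_uniq d1 d1'.
Qed.

Lemma theta_graph_dom (F : SGL) x z : theta_graph F x z -> sgl_dom F x.
Proof.
move=> [mu [g [nu [y [w [Ft c1 _ _]]]]]]; exists (mu, g, nu) => //; exists y => //.
by case: c1.
Qed.

(* By [theta_graph_ex] and [theta_graph_uniq] this is the function with graph
   [theta_graph F] on D^{F^*F}; its value outside D^{F^*F} is irrelevant. *)
Definition theta (F : SGL) x : boundary_path L := xget x (theta_graph F x).

Definition theta_irreducible :=
  forall U : set (boundary_path L), open U ->
    (forall F : SGL, theta F @` (U `&` sgl_dom F) `<=` U) ->
    U = set0 \/ U = setT.

(* equality of germs, for pairs (F, x) with x in D^{F^*F} *)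
Definition germ_eq (p q : SGL * boundary_path L) :=
  p.2 = q.2 /\
  exists E : SGL, [/\ sgl_idempotent E, sgl_dom E p.2
    & sgl_mul p.1 E = sgl_mul q.1 E].

Record tight_germ := TightGerm {
  germ_class : set (SGL * boundary_path L);
  germ_classP : exists2 p : SGL * boundary_path L, sgl_dom p.1 p.2 &
    germ_class = [set q | sgl_dom q.1 q.2 /\ germ_eq p q]
}.

(* a representative (F, x) of the germ [F, x] *)
Definition germ_rep (c : tight_germ) : SGL * boundary_path L :=
  s2val (cid2 (germ_classP c)).
Definition germ_source (c : tight_germ) : boundary_path L := (germ_rep c).2.
Definition germ_range (c : tight_germ) : boundary_path L :=
  theta (germ_rep c).1 (germ_rep c).2.

End SelfSimilar.

(* Minimality only involves the topology of the unit space X and the source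
   and range maps of the arrows. *)
Definition groupoid_minimal (X : topologicalType) (A : Type) (s r : A -> X) :=
  forall U : set X, open U -> (forall a, U (s a) <-> U (r a)) ->
    U = set0 \/ U = setT.

(* Main.v *)
Require Import Defs.
From mathcomp Require Import all_boot all_order all_algebra.
From mathcomp Require Import mathcomp_extra boolp classical_sets functions cardinality.
From mathcomp Require Import topology finmap.

(* Write x ~ z when theta_F(x) = z for some F. An element F may be replaced by
   one of its triples, so ~ is symmetric; and a germ [F, x] determines
   theta_F(x) because the triples of an idempotent are of the form (xi, 1, xi).
   Hence (1) and (2) both say that an open set saturated for ~ is trivial.

   (3) => (1): a nonempty open set contains a cylinder Z(t), since a boundary
   path has to enter every finite exhaustive set.  Given x, a path l from s(t)
   to g . x(n) yields the triple (t l, g, x(0,n)), whose action moves x into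
   Z(t).

   (1) => (3): for a vertex v, the boundary paths x such that v reaches some
   g . x(n) form an open saturated set, which is nonempty because v is the range
   of a boundary path. *)

Set Implicit Arguments.
Unset Strict Implicit.
Unset Printing Implicit Defensive.

Import GRing.Theory.
Local Open Scope classical_set_scope.
Local Open Scope ring_scope.

(** * Finite and extended degrees *)

Section Degrees.
Variable k : nat.
Implicit Types (m n : Nk k) (a b : Nki k).

Lemma subk0 n : subk n 0 = n.
Proof. by apply/ffunP => i; rewrite !ffunE subn0. Qed.

Lemma lek_joinE m n : lek m n -> joink m n = n.
Proof. by move=> /forallP h; apply/ffunP => i; rewrite ffunE; apply/maxn_idPr. Qed.

Lemma leki_join m n a : leki m a -> leki n a -> leki (joink m n) a.
Proof.
move=> /forallP hm /forallP hn; apply/forallP => i; have := hm i; have := hn i.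
by rewrite ffunE; case: (a i) => // c; rewrite geq_max => -> ->.
Qed.

(** Testing against degrees supported on one coordinate recovers that coordinate, infinite values
    included. *)
Lemma leki_inj a b : (forall n, leki n a <-> leki n b) -> a = b.
Proof.
move=> h; apply/ffunP => i.
have hi c : (if a i is Some d then (c <= d)%N else true) =
            (if b i is Some d then (c <= d)%N else true).
  have E (e : Nki k) : leki [ffun j => if j == i then c else 0%N] e =
      (if e i is Some d then (c <= d)%N else true).
    apply/forallP/idP => [/(_ i)|H j]; rewrite ffunE ?eqxx //.
    by case: eqP => [->//|_]; case: (e j).
  by rewrite -!E; apply/idP/idP => /h.
case: (a i) (b i) hi => [c|] [d|] hi //.
- by congr Some; apply/anti_leq; rewrite -(hi c) leqnn (hi d) leqnn.
- by have := hi c.+1; rewrite ltnn.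
- by have := hi d.+1; rewrite ltnn.
Qed.

Lemma leki_add2l n m a : leki (n + m) (addki n a) = leki m a.
Proof.
apply/forallP/forallP => h i; have := h i; rewrite !ffunE;
  by case: (a i) => //= c; rewrite leq_add2l.
Qed.

Lemma addki_sub n a : leki n a -> exists b, a = addki n b.
Proof.
move=> /forallP h; exists [ffun i => omap (subn^~ (n i)) (a i)].
apply/ffunP => i; have := h i; rewrite !ffunE.
by case: (a i) => //= c hc; rewrite subnKC.
Qed.

End Degrees.

(** * Prefixes of paths and initial segments of boundary paths *)

Section Prefixes.
Variables (k : nat) (L : kgraph k).
Implicit Types (a b c l v : L) (x y z w : boundary_path L).

Definition kprefix a c := exists2 b, ks a = kr b & c = kcomp a b.

Lemma kprefix_refl a : kprefix a a.
Proof. by exists (ks a); rewrite ?kr_s ?kcomp_s. Qed.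

Lemma kprefix_trans b a c : kprefix a b -> kprefix b c -> kprefix a c.
Proof.
move=> [b' ab ->] [c' bc ->]; rewrite ks_comp // in bc.
by exists (kcomp b' c'); rewrite ?kr_comp ?kcompA.
Qed.

Lemma kprefix_lek a c : kprefix a c -> lek (kd a) (kd c).
Proof. by move=> [b ab ->]; rewrite kd_comp // lek_addr. Qed.

Lemma kprefix_uniq a b c : kprefix a c -> kprefix b c -> kd a = kd b -> a = b.
Proof. by move=> [a' h ->] [b' h' e] d; have [] := kcomp_inj h h' d e. Qed.

Lemma kprefix_cancel a b c : ks a = kr b -> ks a = kr c ->
  kprefix (kcomp a b) (kcomp a c) -> kprefix b c.
Proof.
move=> ab ac [d]; rewrite ks_comp // => bd; rewrite -kcompA // => e.
by exists d => //; have [|//] := kcomp_inj ac _ erefl e; rewrite kr_comp.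
Qed.

(** The prefix of [b] of degree [kd a] is a prefix of [c] too, so unique factorisation identifies it
    with [a]. *)
Lemma kprefix_ge a b c : kprefix a c -> kprefix b c -> lek (kd a) (kd b) -> kprefix a b.
Proof.
move=> ac bc h; have [d [e [de dd E]]] := prefix_ex h.
have db : kprefix d b by exists e.
by rewrite (@kprefix_uniq a d c) //; apply: kprefix_trans bc.
Qed.

(** Every common extension factors through a minimal one, so nonemptiness of [Lmin] can ignore the
    degree condition. *)
Lemma Lmin_prefixP a b : Lmin a b !=set0 <-> exists2 c, kprefix a c & kprefix b c.
Proof.
split=> [[[al be] [/= h1 h2 h3 _]]|[c [d h ->] [e h' E]]].
  by exists (kcomp a al); [exists al | rewrite h3; exists be].
exact: Lmin_common E.
Qed.

Lemma kprefix_join a b c : kprefix a c -> kprefix b c ->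
  exists al be, [/\ Lmin a b (al, be) & kprefix (kcomp a al) c].
Proof.
move=> [d h ->] [e h' E].
have [al [be [t [H h1 h2 -> _]]]] := common_ext h h' E.
exists al, be; split => //; case: H => /= h3 _ _ _.
by rewrite kcompA //; exists t => //; rewrite ks_comp.
Qed.

(** Cylinder membership without naming a tail (see [ZsetE]). The bound [hl] is existential because
    [bseg] takes it as an argument. *)
Definition starts l x :=
  exists hl : leki (kd l) (bd x), bseg (lek0 (kd l)) hl = l.

Lemma starts_d l x : starts l x -> leki (kd l) (bd x).
Proof. by case. Qed.

Lemma starts_bseg n x (hn : leki n (bd x)) : starts (bseg (lek0 n) hn) x.
Proof.
have e : kd (bseg (lek0 n) hn) = n by rewrite bseg_d subk0.
have h : leki (kd (bseg (lek0 n) hn)) (bd x) by rewrite e.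
by exists h; apply: bsegE.
Qed.

Lemma starts_ex n x : leki n (bd x) -> exists2 a, starts a x & kd a = n.
Proof.
move=> hn; exists (bseg (lek0 n) hn); first exact: starts_bseg.
by rewrite bseg_d subk0.
Qed.

Lemma starts_uniq a b x : starts a x -> starts b x -> kd a = kd b -> a = b.
Proof. by move=> [ha ea] [hb eb] e; rewrite -ea -eb; apply: bsegE. Qed.

Lemma starts_total a b x : starts a x -> starts b x -> lek (kd a) (kd b) -> kprefix a b.
Proof.
move=> [ha ea] [hb eb] h; have [h1 h2] := bseg_split (lek0 _) h (lek0 _) ha hb.
by rewrite eb ea in h1 h2; eexists; eauto.
Qed.

Lemma starts_prefix a b x : kprefix a b -> starts b x -> starts a x.
Proof.
move=> ab sb; have hb := starts_d sb.
have [c sc dc] := starts_ex (leki_trans (kprefix_lek ab) hb).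
suff -> : a = c by [].
apply: (kprefix_uniq ab) (esym dc); apply: starts_total sc sb _.
by rewrite dc kprefix_lek.
Qed.

Lemma starts_join a b x : starts a x -> starts b x ->
  exists c, [/\ starts c x, kprefix a c & kprefix b c].
Proof.
move=> sa sb; have [c sc dc] := starts_ex (leki_join (starts_d sa) (starts_d sb)).
exists c; split => //; [apply: (starts_total sa sc)|apply: (starts_total sb sc)].
  by rewrite dc lek_joinl.
by rewrite dc lek_joinr.
Qed.

Lemma starts_r a x : starts a x -> kr a = brange x.
Proof. by move=> [h <-]; apply: bseg_r. Qed.

Lemma starts_brange x : starts (brange x) x.
Proof.
rewrite (_ : brange x = bseg (lek0 0) (leki0 (bd x))); first exact: starts_bseg.
exact: bsegE.
Qed.

(** Initial segments reveal the degree by [leki_inj], and there is one for each degree below it.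
    From here on a boundary path is handled through its set of initial segments. *)
Lemma starts_inj x y : (forall a, starts a x <-> starts a y) -> x = y.
Proof.
move=> h; apply: bsegI.
  apply: leki_inj => n; split => /starts_ex [a /h sa <-]; exact: starts_d sa.
move=> n hx hy; apply: (@starts_uniq _ _ y).
- exact/h/starts_bseg.
- exact: starts_bseg.
- by rewrite !bseg_d.
Qed.

Lemma concat_starts l y x b : is_concat l y x -> ks l = kr b ->
  starts (kcomp l b) x <-> starts b y.
Proof.
move=> [ry dx [hl sl] seg] lb.
have E q (hy : leki q (bd y)) (hx : leki (kd l + q) (bd x)) :
    ks l = kr (bseg (lek0 q) hy) /\
    bseg (lek0 (kd l + q)) hx = kcomp l (bseg (lek0 q) hy).
  split; first by rewrite (bseg_r _ _ (leki0 _)) -ry.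
  have [_ ->] := bseg_split (lek0 (kd l)) (lek_addr (kd l) q) (lek0 _) hl hx.
  by rewrite sl -(seg _ _ _ _ hx); congr kcomp; apply: bsegE; rewrite ?addr0.
have dE := kd_comp lb; split=> -[h e].
  have hx : leki (kd l + kd b) (bd x) by rewrite -dE.
  have hy : leki (kd b) (bd y) by rewrite -(leki_add2l (kd l)) -dx.
  exists hy; have [h1 h2] := E _ hy hx.
  have K : kcomp l b = kcomp l (bseg (lek0 _) hy).
    by rewrite -h2 -[LHS]e; apply: bsegE.
  by have [_ <-] := kcomp_inj lb h1 erefl K.
have hx : leki (kd l + kd b) (bd x) by rewrite dx leki_add2l.
have hx' : leki (kd (kcomp l b)) (bd x) by rewrite dE.
exists hx'; have [_ e'] := E _ h hx; rewrite e in e'.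
by rewrite -[RHS]e'; apply: bsegE.
Qed.

(** The tail is [x] read on the translate of [Omega m] by [n]; its boundary condition at [p] is that
    of [x] at [n + p]. *)
Lemma starts_shift l x : starts l x -> exists y, is_concat l y x.
Proof.
move=> sl; have [hl _] := sl; have [m dx] := addki_sub hl; pose n := kd l.
have hb q : leki q m -> leki (n + q) (bd x) by rewrite dx leki_add2l.
pose sh (c : Omega m) : Omega (bd x) :=
  Omega_pair (lek_add2l n (Omega_le c)) (hb _ (Omega_bd c)).
pose f (c : Omega m) : L := x (sh c).
have subD p q : subk (n + q) (n + p) = subk q p.
  by apply/ffunP => i; rewrite !ffunE subnDl.
have fr (c : Omega m) : f (kr c) = kr (f c).
  by rewrite /f -bfun_r; congr (bfun _); apply: val_inj.
have fs (c : Omega m) : f (ks c) = ks (f c).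
  by rewrite /f -bfun_s; congr (bfun _); apply: val_inj.
have fc (c c' : Omega m) : ks c = kr c' -> f (kcomp c c') = kcomp (f c) (f c').
  move=> cc; have e := Omega_sr cc.
  have cc' : ks (sh c) = kr (sh c') by apply: Omega_srE => /=; rewrite e.
  rewrite /f -bfun_comp //; congr (bfun _); apply: val_inj.
  by rewrite [RHS]val_Omega_comp //= val_Omega_comp.
have fd (c : Omega m) : kd (f c) = kd c by rewrite /f bfun_d; apply: subD.
have fb (p : Nk k) (hp : leki p m) X : FE (f (Omega_pair (lekk p) hp)) X ->
    exists2 l, X l & exists hl : leki (p + kd l) m,
      f (Omega_pair (lek_addr p (kd l)) hl) = l.
  move=> FX; have [|a Xa [ha ea]] := @bfun_boundary _ _ x (n + p) (hb _ hp) X.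
    by congr (FE _ X): FX; congr (bfun _); apply: val_inj.
  have ha' : leki (p + kd a) m by rewrite -(leki_add2l n) -dx addrA.
  exists a => //; exists ha'; rewrite -[RHS]ea; congr (bfun _); apply: val_inj.
  by rewrite /= addrA.
exists (BoundaryPath fr fs fc fd fb); split => //.
- have [h1 h2] := sl; rewrite -[in RHS]h2 bseg_s.
  by rewrite /brange /bvert /bseg /= /f; congr (bfun _); apply: val_inj; rewrite /= addr0.
- by move=> p q pq qy qx; rewrite /bseg /= /f; congr (bfun _); apply: val_inj.
Qed.

(** For the converse, [x] has some tail after [l] by [starts_shift], and [starts_inj] identifies
    that tail with [y]. *)
Lemma concatP l y x : is_concat l y x <->
  brange y = ks l /\ forall b, ks l = kr b -> starts (kcomp l b) x <-> starts b y.
Proof.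
split=> [c|[ry h]]; first by split=> [|b lb]; [case: c | apply: concat_starts].
have sl : starts l x.
  rewrite -[l]kcomp_s; apply/h; rewrite ?kr_s // -ry; exact: starts_brange.
have [y' c] := starts_shift sl; suff <- : y' = y by [].
have ry' : brange y' = ks l by case: c.
apply: starts_inj => b; split=> sb; have rb := starts_r sb.
  by apply/h; rewrite ?(concat_starts c) // -ry' -rb.
by apply/(concat_starts c); rewrite ?h // -ry -rb.
Qed.

Lemma concat_head l y x : is_concat l y x -> starts l x.
Proof. by case. Qed.

Lemma ZsetE l x : Zset l x <-> starts l x.
Proof.
split=> [[y _]|/starts_shift [y c]]; first exact: concat_head.
by exists y => //; case: c.
Qed.

Lemma concatA l a w y x : ks l = kr a ->
  is_concat l y x -> is_concat a w y -> is_concat (kcomp l a) w x.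
Proof.
move=> la /concatP [ry hy] /concatP [rw hw]; apply/concatP.
split=> [|b]; first by rewrite ks_comp.
by rewrite ks_comp // => ab; rewrite -kcompA // hy ?kr_comp // hw.
Qed.

End Prefixes.

(** * Directed families and the construction of boundary paths *)

(** Finitely many monotone conditions, each met somewhere in a directed family, are met at once. It
    serves for coordinates, for exhaustive sets and for neighbourhoods. *)
Lemma directed_finite (T U : Type) (X : set T) (P : set U) (le : U -> U -> Prop)
    (Q : T -> U -> Prop) :
  finite_set X -> P !=set0 ->
  (forall a b, P a -> P b -> exists c, [/\ P c, le a c & le b c]) ->
  (forall t a b, le a b -> Q t a -> Q t b) ->
  (forall t, X t -> exists2 a, P a & Q t a) ->
  exists2 a, P a & forall t, X t -> Q t a.
Proof.
move=> /(@finite_seqP {classic T})[s ->] [a0 Pa0] dir mono; elim: s => [|t s IH] H.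
  by exists a0.
have [|a Pa Qa] := IH; first by move=> u us; apply: H; rewrite /= in_cons us orbT.
have [|b Pb Qb] := H t; first by rewrite /= in_cons eqxx.
have [c [Pc ac bc]] := dir _ _ Pa Pb; exists c => // u /=; rewrite in_cons.
by case/orP => [/eqP ->|us]; [apply: mono bc Qb|apply: mono ac (Qa _ us)].
Qed.

(** The supremum is taken coordinatewise, with [None] where [D] is unbounded. A finite degree below
    it is dominated one coordinate at a time, and directedness yields one member for all
    coordinates. *)
Lemma directed_sup k (D : set (Nk k)) : D !=set0 ->
  (forall d e, D d -> D e -> exists f, [/\ D f, lek d f & lek e f]) ->
  exists m : Nki k, forall n, leki n m <-> exists2 d, D d & lek n d.
Proof.
move=> [d0 Dd0] dir.
have ex i : exists o : option nat, forall c : nat,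
    (if o is Some d then (c <= d)%N else true) = true <-> exists2 d, D d & (c <= d i)%N.
  case: (pselect (exists b, forall d, D d -> (d i <= b)%N)) => [[b hb]|nb].
    pose p := [pred c | `[< exists2 d, D d & (c <= d i)%N >]].
    have p0 : exists c, p c by exists 0%N; apply/asboolP; exists d0.
    have pb c : p c -> (c <= b)%N.
      by move=> /asboolP[d Dd h]; apply: leq_trans h (hb _ Dd).
    case: (ex_maxnP p0 pb) => c /asboolP[d Dd cd] maxc; exists (Some c) => c'.
    split=> [h|[e De h]]; first by exists d => //; apply: leq_trans cd.
    by apply: maxc; apply/asboolP; exists e.
  exists None => c; split=> // _; apply: contrapT => H; apply: nb; exists c => d Dd.
  by rewrite leqNgt; apply/negP => h; apply: H; exists d => //; apply: ltnW.
have [m hm] := choice ex; exists [ffun i => m i] => n; split=> [/forallP h|].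
  have [||d Dd H] := @directed_finite _ _ [set: 'I_k] D (@lek k)
    (fun i d => (n i <= d i)%N) finite_finset (ex_intro _ d0 Dd0) dir.
  - by move=> i a b /forallP ab ni; apply: leq_trans ni (ab i).
  - by move=> i _; apply/hm; have := h i; rewrite ffunE.
  - by exists d => //; apply/forallP => i; apply: H.
by move=> [d Dd /forallP h]; apply/forallP => i; rewrite ffunE; apply/hm; exists d.
Qed.

Section Existence.
Variables (k : nat) (L : kgraph k).
Implicit Types (a b c l v : L) (x y z w : boundary_path L).

(** The hypotheses make [P] an ultrafilter of paths. Directedness glues its members into a path
    whose degree is the supremum of theirs; maximality gives the boundary condition. *)
Lemma boundary_of_prefixes (P : set L) : P !=set0 ->
  (forall a b, kprefix a b -> P b -> P a) ->
  (forall a b, P a -> P b -> exists c, [/\ P c, kprefix a c & kprefix b c]) ->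
  (forall c, P c \/ exists2 a, P a & ~ (Lmin a c !=set0)) ->
  exists x, forall a, starts a x <-> P a.
Proof.
move=> P0 Ppre dir ultra; have [a0 Pa0] := P0.
have [||m hm] := @directed_sup k (@kd k L @` P).
- by exists (kd a0), a0.
- move=> _ _ [a Pa <-] [b Pb <-]; have [c [Pc ac bc]] := dir _ _ Pa Pb.
  by exists (kd c); split; [exists c | exact: kprefix_lek..].
(* [I q] will be the member of [P] of degree [q]; when [q] is not below [m] its value is
   arbitrary. *)
have exI (q : Nk k) : exists a, leki q m -> P a /\ kd a = q.
  case: (pselect (leki q m)) => [/hm[_ [c Pc <-] qc]|]; last by exists a0.
  have [a [b [ab da e]]] := prefix_ex qc; exists a => _; split=> //.
  by apply: Ppre Pc; exists b.
have [I hI] := choice exI.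
have pI p q : leki p m -> leki q m -> lek p q -> kprefix (I p) (I q).
  move=> /hI[Pp dp] /hI[Pq dq] pq; have [c [_ pc qc]] := dir _ _ Pp Pq.
  by apply: kprefix_ge pc qc _; rewrite dp dq.
have [||f [fr fs fc fd f0]] := @path_family k L m (fun q _ => I q).
- by move=> q /hI[].
- by move=> p q hp hq pq; have [b] := pI _ _ hp hq pq; exists b.
have seg (p q : Nk k) (pq : lek p q) (hq : leki q m) :
    ks (I p) = kr (f (Omega_pair pq hq)) /\ I q = kcomp (I p) (f (Omega_pair pq hq)).
  pose A : Omega m := Omega_pair (lek0 p) (leki_trans pq hq).
  pose B : Omega m := Omega_pair pq hq.
  have AB : ks A = kr B by exact: Omega_srE.
  have E : kcomp A B = Omega_pair (lek0 q) hq.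
    by apply: val_inj; rewrite /= val_Omega_comp.
  rewrite -!(f0 _ (leki_trans pq hq)) -(f0 q hq) -E; split; last exact: fc.
  by rewrite -fs -fr -/A AB.
have fb (p : Nk k) (hp : leki p m) X : FE (f (Omega_pair (lekk p) hp)) X ->
    exists2 l, X l & exists hl : leki (p + kd l) m,
      f (Omega_pair (lek_addr p (kd l)) hl) = l.
  have [Pp dp] := hI _ hp.
  have -> : f (Omega_pair (lekk p) hp) = ks (I p).
    by rewrite -(f0 p hp) -fs; congr f; apply: val_inj.
  move=> [finX Xv exh]; apply: contrapT => no.
  have Xr l : X l -> ks (I p) = kr l by move=> /Xv[].
  have noP l : X l -> ~ P (kcomp (I p) l).
    move=> Xl Pl; apply: no; exists l => //.
    have dl : kd (kcomp (I p) l) = p + kd l by rewrite (kd_comp (Xr _ Xl)) dp.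
    have hl : leki (p + kd l) m.
      by apply/hm; exists (kd (kcomp (I p) l)); [exists (kcomp (I p) l)|rewrite dl lekk].
    exists hl; have [h1 h2] := seg _ _ (lek_addr p (kd l)) hl.
    have [Pq dq] := hI _ hl.
    have [c [_ c1 c2]] := dir _ _ Pq Pl.
    have e := kprefix_uniq c1 c2 (etrans dq (esym dl)).
    rewrite e in h2; by have [_ <-] := kcomp_inj (Xr _ Xl) h1 erefl h2.
  (* If no [l] in [X] is followed, [ultra] makes each [kcomp (I p) l] incompatible with a member of
     [P]. One extension [c] of [I p] in [P] is then incompatible with all of them. *)
  have [||||c [Pc pc] H] := @directed_finite _ _ X
    [set c | P c /\ kprefix (I p) c] (@kprefix k L)
    (fun l c => ~ (Lmin c (kcomp (I p) l) !=set0)) finX.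
  - by exists (I p); split=> //; apply: kprefix_refl.
  - move=> a b [Pa pa] [Pb pb]; have [c [Pc ac bc]] := dir _ _ Pa Pb.
    by exists c; split=> //; split=> //; apply: kprefix_trans ac.
  - move=> l a b ab na /Lmin_prefixP[c bc lc]; apply: na; apply/Lmin_prefixP.
    by exists c => //; apply: kprefix_trans bc.
  - move=> l Xl; case: (ultra (kcomp (I p) l)) => [Pl|[a Pa na]].
      by case: (noP l Xl).
    have [c [Pc ac pc]] := dir _ _ Pa Pp; exists c; first by split.
    move=> /Lmin_prefixP[d cd ld]; apply: na; apply/Lmin_prefixP.
    by exists d => //; apply: kprefix_trans cd.
  (* The remainder [t] of [c] beyond [I p] meets some [l] in the exhaustive set, which contradicts
     the choice of [c]. *)
  have [t pt ct] := pc; have [|l Xl tl] := exh t; first by rewrite /paths_to /= pt.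
  by apply: (H l Xl); rewrite ct; apply: Lmin_mul => //; apply: Xr.
have sI a (h : leki (kd a) m) :
    starts a (BoundaryPath fr fs fc fd fb) <-> I (kd a) = a.
  split=> [[h' e]|e]; first by rewrite -[RHS]e /bseg /= f0.
  by exists h; rewrite /bseg /= f0.
exists (BoundaryPath fr fs fc fd fb) => a; split=> [sa|Pa].
  have h := starts_d sa; have [Pi _] := hI _ h.
  by rewrite -((sI a h).1 sa).
have h : leki (kd a) m by apply/hm; exists (kd a); [exists a|exact: lekk].
apply/sI => //; have [Pi di] := hI _ h; have [c [_ c1 c2]] := dir _ _ Pi Pa.
exact: kprefix_uniq c1 c2 di.
Qed.

(* Countability makes a generic increasing sequence of paths suffice: step j
   extends the current path past the j-th path c whenever possible. *)
Lemma boundary_path_ex a : exists x, starts a x.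
Proof.
have /countable_injP[f finj] := @kcountable k L.
have step (jb : nat * L) : exists b, kprefix jb.2 b /\
    forall c, f c = jb.1 -> kprefix c b \/ ~ (Lmin jb.2 c !=set0).
  have finj' c c' : f c = f c' -> c = c' by apply: finj; apply: mem_set.
  case: jb => j b /=.
  case: (pselect (exists2 c, f c = j & Lmin b c !=set0)) => [[c <-]|H].
    move=> /Lmin_prefixP[d bd cd]; exists d; split=> // c' /finj' ->; by left.
  exists b; split=> [|c fc]; first exact: kprefix_refl.
  by right=> H'; apply: H; exists c.
have [next hnext] := choice step.
pose s := fix s j := if j is i.+1 then next (i, s i) else a.
have smono i j : (i <= j)%N -> kprefix (s i) (s j).
  elim: j => [|j IH]; first by rewrite leqn0 => /eqP ->; apply: kprefix_refl.
  rewrite leq_eqVlt ltnS => /orP[/eqP ->|/IH h]; first exact: kprefix_refl.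
  by apply: kprefix_trans h _; have [] := hnext (j, s j).
have [||||x hx] := @boundary_of_prefixes [set c | exists j, kprefix c (s j)].
- by exists a, 0%N; apply: kprefix_refl.
- by move=> b c bc [j cj]; exists j; apply: kprefix_trans cj.
- move=> b c [i bi] [j cj]; exists (s (maxn i j)); split.
  + by exists (maxn i j); apply: kprefix_refl.
  + by apply: kprefix_trans bi (smono _ _ (leq_maxl _ _)).
  + by apply: kprefix_trans cj (smono _ _ (leq_maxr _ _)).
(* The path [c] was treated at step [f c]: it is a prefix of [s (f c).+1] or incompatible with
   [s (f c)]. *)
- move=> c; have [_ /(_ c erefl)[h|h]] := hnext (f c, s (f c)).
    by left; exists (f c).+1.
  by right; exists (s (f c)) => //; exists (f c); apply: kprefix_refl.
by exists x; apply/hx; exists 0%N; apply: kprefix_refl.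
Qed.

(** * Neighbourhoods in the boundary path space *)

Lemma basic_open_open (A : set (boundary_path L)) : basic_open A -> open A.
Proof.
move=> bA; exists [set A]; last by rewrite bigcup_set1.
by move=> _ ->; apply: finI_from1.
Qed.

Lemma open_starts l : open [set x : boundary_path L | starts l x].
Proof.
apply: basic_open_open; exists l, set0; split=> //.
by apply/seteqP; split=> x; rewrite bigcup_set0 setD0 => /ZsetE.
Qed.

(** A finite intersection of basic sets around [z] lies in [U]. One initial segment of [z] extends
    all their cylinder paths, and [M] collects the removed paths, which need not extend [l]. *)
Lemma open_local_base (U : set (boundary_path L)) z : open U -> U z ->
  exists l (M : set L), [/\ finite_set M, starts l z,
    forall f, M f -> ~ starts f z
    & forall y, starts l y -> (forall f, M f -> ~ starts f y) -> U y].
Proof.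
move=> [B sB <-] [A BA Az]; have [] := sB _ BA.
move=> /= D sD eA; pose D' := D : {fset set (boundary_path L)}.
have {}eA : \bigcap_(C in [set` D']) C = A := eA.
have {}sD C : C \in D' -> basic_open C by move=> /sD/set_mem.
pose P (p : L * set L) := [/\ finite_set p.2, starts p.1 z
  & forall f, p.2 f -> ~ starts f z].
pose le (p q : L * set L) := kprefix p.1 q.1 /\ p.2 `<=` q.2.
pose Q (C : set (boundary_path L)) (p : L * set L) := forall y, starts p.1 y ->
  (forall f, p.2 f -> ~ starts f y) -> C y.
have [||||[l M] [fM sl nM] H] := @directed_finite _ _ [set` D'] P le Q (finite_fset D').
- by exists (brange z, set0); split=> //; apply: starts_brange.
- move=> [l M] [l' M'] [/= f1 s1 n1] [/= f2 s2 n2].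
  have [c [sc lc lc']] := starts_join s1 s2.
  exists (c, M `|` M'); split; last by split=> // ? ?; right.
    by split=> //=; [rewrite finite_setU | move=> f [/n1|/n2]].
  by split=> // ? ?; left.
- move=> C [l M] [l' M'] [/= ll MM] h y sy nM'; apply: h => [|f /MM /nM' //].
  exact: starts_prefix sy.
- move=> C DC; have Cz : C z by move: Az; rewrite -eA; apply.
  have := sD _ DC.
  move=> [l [N [fN Nl eC]]]; exists (l, kcomp l @` N).
    move: Cz; rewrite eC => -[/ZsetE sl nz]; split=> //=.
      exact: finite_image.
    by move=> _ [n Nn <-] sn; apply: nz; exists n => //; apply/ZsetE.
  move=> y /= sy ny; rewrite eC; split; first exact/ZsetE.
  by move=> [n Nn /ZsetE]; apply: ny; exists n.
exists l, M; split=> // y sy ny; exists A => //; rewrite -eA => C DC; exact: H.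
Qed.

(* If every extension of l met M, the minimal common extensions of l with M
   would form a finite exhaustive set at s(l), which z has to enter. *)
Lemma starts_avoid l z (M : set L) : finitely_aligned L -> finite_set M ->
  starts l z -> (forall f, M f -> ~ starts f z) ->
  exists2 t, kprefix l t & forall f, M f -> ~ (Lmin t f !=set0).
Proof.
move=> fa fM sl nM; apply: contrapT => no.
pose X := [set a | exists2 f, M f & exists b, Lmin l f (a, b)].
have nX a : X a -> ks l = kr a /\ ~ starts (kcomp l a) z.
  move=> [f Mf [b [/= h1 h2 h3 _]]]; split=> // s; apply: (nM f Mf).
  by apply: starts_prefix s; rewrite h3; exists b.
have [y c] := starts_shift sl.
have FX : FE (ks l) X.
  split.
  - apply: (@sub_finite_set _ _ (\bigcup_(f in M) (fst @` Lmin l f))).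
      by move=> a [f Mf [b H]]; exists f => //; exists (a, b).
    by apply: bigcup_finite => // f _; apply: finite_image.
  - move=> a Xa; have [h1 h2] := nX _ Xa; split=> //= e.
    by apply: h2; rewrite e kcomp_s.
  - move=> t lt; have lt' : ks l = kr t by [].
    have [f Mf] : exists2 f, M f & Lmin (kcomp l t) f !=set0.
      apply: contrapT => h; apply: no; exists (kcomp l t); first by exists t.
      by move=> f Mf ne; apply: h; exists f.
    move=> /Lmin_prefixP[d ltd fd].
    have ld : kprefix l d by apply: kprefix_trans ltd; exists t.
    (* Both [kcomp l al] and [kcomp l t] are prefixes of [d]; cancelling [l] gives a common
       extension of [al] and [t]. *)
    have [al [be [H ald]]] := kprefix_join ld fd.
    exists al; first by exists f => //; exists be.
    have [/= h1 _ _ _] := H; have [e le de] := ld.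
    rewrite de in ltd ald; apply/Lmin_prefixP; exists e; exact: kprefix_cancel le _.
have ry : brange y = ks l by case: c.
have [a Xa [ha ea]] : exists2 a, X a & exists ha : leki (0 + kd a) (bd y),
    y (Omega_pair (lek_addr 0 (kd a)) ha) = a.
  by apply: (@bfun_boundary _ _ y 0 (leki0 _)); rewrite -ry in FX.
have [h1 []] := nX _ Xa; apply/(concat_starts c) => //.
have ha' : leki (kd a) (bd y) by rewrite -[kd a]add0r.
exists ha'; rewrite -[RHS]ea; congr (bfun _); apply: val_inj => /=.
by rewrite add0r.
Qed.

(** The point [z] itself may lie outside the cylinder: [t] prolongs an initial segment of [z] until
    it is incompatible with every removed path. *)
Lemma open_cylinder (U : set (boundary_path L)) z : finitely_aligned L ->
  open U -> U z -> exists t, forall y, starts t y -> U y.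
Proof.
move=> fa oU Uz; have [l [M [fM sl nM h]]] := open_local_base oU Uz.
have [t lt nt] := starts_avoid fa fM sl nM; exists t => y sy.
apply: h => [|f Mf sf]; first exact: starts_prefix sy.
apply: (nt f Mf); apply/Lmin_prefixP.
by have [c [_ tc fc]] := starts_join sy sf; exists c.
Qed.

End Existence.

(** * The group action on boundary paths *)

Section Action.
Variables (k : nat) (L : kgraph k) (G : groupType) (S : self_similar L G).
Local Notation act := (ssact S).
Local Notation phi := (sscoc S).
Implicit Types (g h : G) (a b c l mu nu : L) (x y z w : boundary_path L) (E F : SGL S).

Lemma sscoc1 a : phi 1%g a = 1%g.
Proof.
by have := sscocM S 1%g 1%g a; rewrite mulg1 ssact1 => /(canLR (mulgK _)); rewrite mulgV.
Qed.

(** As [g] preserves degrees, a correspondence of initial segments already forces [bd y = bd x]. *)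
Lemma bactP g x y : is_bact S g x y <-> forall a, starts a x <-> starts (act g a) y.
Proof.
split=> [[dy h] a|h].
  have E (hx : leki (kd a) (bd x)) (hy : leki (kd (act g a)) (bd y)) :
      bseg (lek0 _) hy = act g (bseg (lek0 _) hx).
    rewrite -(h _ _ (eq_ind_r (leki _) hx dy)); apply: bsegE => //.
    exact: ssact_d.
  split=> -[hl e].
    have hy : leki (kd (act g a)) (bd y) by rewrite ssact_d dy.
    by exists hy; rewrite (E hl) e.
  have hx : leki (kd a) (bd x) by rewrite -dy -(ssact_d S g).
  by exists hx; apply: (can_inj (actK S g)); rewrite -E.
have dxy : bd y = bd x.
  apply: leki_inj => n; split=> /starts_ex [a sa <-].
    have := (h (act g^-1%g a)).2; rewrite actVK => /(_ sa)/starts_d.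
    by rewrite ssact_d.
  by have /starts_d := (h a).1 sa; rewrite ssact_d.
split=> // n hx hy; apply: (@starts_uniq _ _ _ _ y).
- exact: starts_bseg.
- exact/h/starts_bseg.
- by rewrite ssact_d !bseg_d.
Qed.

Lemma bactV g x y : is_bact S g x y -> is_bact S g^-1%g y x.
Proof.
by move=> /bactP h; apply/bactP => a; rewrite h actVK.
Qed.

(** The boundary version of g . (a b) = (g . a)(phi(g, a) . b), obtained by comparing initial
    segments. *)
Lemma bact_tail g a x x' y y' : is_concat a x' x -> is_concat (act g a) y' y ->
  is_bact S g x y -> is_bact S (phi g a) x' y'.
Proof.
move=> cx cy /bactP h; have rx : brange x' = ks a by case: cx.
have ry : brange y' = ks (act g a) by case: cy.
have main b : ks a = kr b -> starts b x' <-> starts (act (phi g a) b) y'.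
  move=> ab; rewrite -(concat_starts cx) // -(concat_starts cy); last first.
    exact: ssact_composable.
  by rewrite h ssact_comp.
(* When [b] does not compose with [a], both sides fail, by the ranges of [x'] and [y']. *)
apply/bactP => b; case: (pselect (ks a = kr b)) => [/main//|nab].
split=> /starts_r e; exfalso; apply: nab.
  by rewrite -rx e.
have := ssact_composable S g (esym (kr_s a)).
rewrite -ry -e !ssact_r kr_s => /(can_inj (actK S (phi g a))) -> //.
Qed.

(** * Single triples and idempotents *)

Lemma single_orth mu g nu t t' : [set (mu, g, nu) : triple L G] t ->
  [set (mu, g, nu)] t' -> t <> t' ->
  Lmin t.1.1 t'.1.1 = set0 /\ Lmin t.2 t'.2 = set0.
Proof. by move=> -> ->. Qed.

Lemma single_source mu g nu : ks mu = act g (ks nu) ->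
  forall t, [set (mu, g, nu)] t -> ks t.1.1 = act t.1.2 (ks t.2).
Proof. by move=> e t ->. Qed.

(** Orthogonality is vacuous for one triple, so each move from nu y to mu (g . y) is realised in the
    semigroup. *)
Definition sgl_single mu g nu (e : ks mu = act g (ks nu)) : SGL S :=
  MkSGL (finite_set1 _) (single_source e) (@single_orth mu g nu).

Lemma SGL_inj E F : (E : set (triple L G)) = F -> E = F.
Proof.
case: E F => [A fA sA oA] [B fB sB oB] /= e; subst B.
by congr MkSGL; apply: Prop_irrelevance.
Qed.

Lemma thetaP F x : sgl_dom F x -> theta_graph F x (theta F x).
Proof. by move=> /theta_graph_ex[z hz]; rewrite /theta; case: xgetP => [y|/(_ z)]. Qed.

Lemma thetaE F x z : theta_graph F x z -> theta F x = z.
Proof. move=> h; exact: theta_graph_uniq (thetaP (theta_graph_dom h)) h. Qed.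

(** The triple of [F] that moves [x], reversed to (nu, g^-1, mu), leads back. *)
Lemma theta_graph_sym F x z : theta_graph F x z -> exists F', theta_graph F' z x.
Proof.
move=> [mu [g [nu [y [w [Ft c1 b c2]]]]]].
have e : ks nu = act g^-1%g (ks mu) by rewrite (sgl_source Ft) /= actK.
exists (sgl_single e), nu, g^-1%g, mu, w, y; split=> //; exact: bactV.
Qed.

Lemma kcomp_deg0 a b : ks a = kr b -> kd (kcomp a b) = kd a -> b = ks a.
Proof.
move=> ab; rewrite kd_comp // -[RHS]addr0 => /addkI/kd0_vertex.
by rewrite -ab.
Qed.

Lemma Lmin_diag a (p : L * L) : Lmin a a p -> p = (ks a, ks a).
Proof.
case: p => al be [/= h1 h2 h3]; rewrite lek_joinE ?lekk // => d.
by rewrite (kcomp_deg0 h1) // (kcomp_deg0 h2) // -h3.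
Qed.

Lemma sgl_idempotent_single l (e : ks l = act 1%g (ks l)) :
  sgl_idempotent (sgl_single e).
Proof.
have key t : Lmin l l t -> (kcomp l (act 1%g t.1),
    (phi 1%g t.1 * phi 1%g (act 1^-1%g t.2))%g, kcomp l (act 1^-1%g t.2)) = (l, 1%g, l).
  by move=> /Lmin_diag -> /=; rewrite invg1 !ssact1 !sscoc1 mulg1 kcomp_s.
apply: SGL_inj; apply/seteqP; split=> t /=.
  by move=> [? [? [? [? [? [? [al [be [[-> -> ->] [-> -> ->] H ->]]]]]]]]]; apply: (key (al, be)).
move=> ->; exists l, 1%g, l, l, 1%g, l, (ks l), (ks l).
have H : Lmin l l (ks l, ks l).
  by split=> //=; rewrite ?kr_s // kcomp_s lek_joinE ?lekk.
by split=> //; rewrite (key (ks l, ks l)).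
Qed.

(** A triple of [E] is a product of two triples of [E], and orthogonality forces both to be that
    triple. Degrees then make [al] and [be] vertices, so the product formula reads nu = mu and g = g
    g. *)
Lemma sgl_idempotentE E mu g nu : sgl_idempotent E -> (E : set _) (mu, g, nu) ->
  nu = mu /\ g = 1%g.
Proof.
move=> idE Et; have : (sgl_mul E E : set _) (mu, g, nu) by rewrite idE.
move=> [mu' [g' [nu' [xi [h [eta [al [be [E1 E2 [/= h1 h2 h3 h4] [e1 e2 e3]]]]]]]]]].
have c1 := act_vertex E1 h1; have c2 := actV_vertex E2 h2.
have t1 : (mu', g', nu') = (mu, g, nu).
  by apply: (sgl_eql E1 Et); apply/Lmin_prefixP; exists mu; [exists (act g' al)|exact: kprefix_refl].
have t2 : (xi, h, eta) = (mu, g, nu).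
  by apply: (sgl_eqr E2 Et); apply/Lmin_prefixP; exists nu; [exists (act h^-1%g be)|exact: kprefix_refl].
case: t1 t2 => ? ? ? [? ? ?]; subst mu' g' nu' xi h eta.
have a0 := kcomp_deg0 c1 (congr1 (@kd _ L) (esym e1)).
have b0 := kcomp_deg0 c2 (congr1 (@kd _ L) (esym e3)).
have va : kd al = 0 by rewrite -(ssact_d S g) a0 kd_s.
have vb : kd (act g^-1%g be) = 0 by rewrite b0 kd_s.
have vb' : kd be = 0 by rewrite -(ssact_d S g^-1%g).
have ea : al = ks nu by rewrite h1 kd0_vertex.
have eb : be = ks mu by rewrite h2 kd0_vertex.
split; first by move: h3; rewrite ea eb !kcomp_s.
by move: e2; rewrite !sscoc_vertex // => /esym/(canRL (mulKg _)); rewrite mulVg.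
Qed.

(** An initial segment of [x] extends both [nu] and the path [xi] of [E]. Refining the triple of [F]
    along their minimal extension gives a triple of the product, with the same effect on [x] by
    [bact_tail]. *)
Lemma theta_graph_mul_idempotent F E x z : sgl_idempotent E -> sgl_dom E x ->
  theta_graph F x z -> theta_graph (sgl_mul F E) x z.
Proof.
move=> idE [[[xi h] eta] Et /ZsetE sxi].
have [e1 e2] := sgl_idempotentE idE Et; rewrite /= in sxi; subst eta h.
move=> [mu [g [nu [y [w [Ft c1 b c2]]]]]].
have [c [sc nuc xic]] := starts_join (concat_head c1) sxi.
have [al [be [Hm pc]]] := kprefix_join nuc xic.
have [/= h1 h2 h3 _] := Hm; have sal := starts_prefix pc sc.
have [y2 cy] := starts_shift ((concat_starts c1 h1).1 sal).
have sw := ((bactP g y w).1 b al).1 (concat_head cy).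
have [w2 cw] := starts_shift sw; have c3 := act_vertex Ft h1.
exists (kcomp mu (act g al)), (phi g al), (kcomp xi be), y2, w2; split.
- exists mu, g, nu, xi, 1%g, xi, al, be; split=> //.
  by rewrite invg1 ssact1 sscoc1 mulg1.
- by rewrite -h3; apply: concatA cy.
- exact: bact_tail cy cw b.
- exact: concatA cw.
Qed.

(** * Germs, their sources and ranges *)

Lemma germ_eq_theta p q : germ_eq p q -> sgl_dom p.1 p.2 -> sgl_dom q.1 q.2 ->
  theta (S := S) p.1 p.2 = theta q.1 q.2.
Proof.
case: p q => [F x] [F' x'] [/= <- [E [idE Ex e]]] Fx F'x.
have h1 := theta_graph_mul_idempotent idE Ex (thetaP Fx).
have h2 := theta_graph_mul_idempotent idE Ex (thetaP F'x).
by rewrite e in h1; apply: theta_graph_uniq h1 h2.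
Qed.

Lemma germ_eq_refl (p : SGL S * boundary_path L) : germ_eq p p.
Proof.
split=> //; have e : ks (brange p.2) = act 1%g (ks (brange p.2)) by rewrite ssact1.
exists (sgl_single e); split=> //; first exact: sgl_idempotent_single.
by exists (brange p.2, 1%g, brange p.2) => //; apply/ZsetE/starts_brange.
Qed.

(** The representative picked by [germ_rep] may differ from [(F, x)], but it is equivalent to it and
    so has the same source and range. *)
Lemma germ_of F x : sgl_dom F x -> exists c : tight_germ S,
  germ_source c = x /\ germ_range c = theta F x.
Proof.
move=> Fx; have cP : exists2 p : SGL S * boundary_path L, sgl_dom p.1 p.2 &
    [set q | sgl_dom q.1 q.2 /\ germ_eq (F, x) q] =
    [set q | sgl_dom q.1 q.2 /\ germ_eq p q] by exists (F, x).
exists (TightGerm cP); rewrite /germ_source /germ_range /germ_rep.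
case: cid2 => p dp /= e.
have [_ pq] : [set q | sgl_dom q.1 q.2 /\ germ_eq (F, x) q] p.
  by rewrite e; split=> //; apply: germ_eq_refl.
by split; [case: pq | rewrite (germ_eq_theta pq)].
Qed.

Lemma germ_dom (c : tight_germ S) : exists F, sgl_dom F (germ_source c) /\
  germ_range c = theta F (germ_source c).
Proof.
rewrite /germ_source /germ_range /germ_rep; case: cid2 => p dp _ /=.
by exists p.1.
Qed.

(** * Invariant open sets and the three conditions *)

Lemma theta_invariantP (U : set (boundary_path L)) :
  (forall F, theta F @` (U `&` sgl_dom F) `<=` U) <->
  (forall F x z, theta_graph F x z -> U x <-> U z).
Proof.
have sub : (forall F, theta F @` (U `&` sgl_dom F) `<=` U) ->
    forall F x z, theta_graph F x z -> U x -> U z.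
  move=> h F x z t Ux; apply: (h F); exists x; last exact: thetaE.
  by split=> //; apply: theta_graph_dom t.
split=> [h F x z t|h F _ [x [Ux Fx] <-]]; last exact: (h F x _ (thetaP Fx)).1.
(* Forward invariance under every element gives the backward direction by reversing the move. *)
by split; [apply: sub h _ _ _ t | have [F' t'] := theta_graph_sym t; apply: sub h _ _ _ t'].
Qed.

Lemma irreducible_minimal :
  theta_irreducible S <->
  groupoid_minimal (@germ_source k L G S) (@germ_range k L G S).
Proof.
split=> h U oU inv; apply: h oU _.
  move=> F _ [x [Ux Fx] <-]; have [c [es er]] := germ_of Fx.
  by rewrite -er; apply/inv; rewrite es.
move/theta_invariantP: inv => inv c; have [F [dc ->]] := germ_dom c.
exact: inv (thetaP dc).
Qed.

Lemma cofinal_irreducible : G_cofinal S -> theta_irreducible S.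
Proof.
move=> cof U oU /theta_invariantP inv.
case: (pselect (U !=set0)) => [[z Uz]|U0]; last first.
  by left; apply/seteqP; split=> // x Ux; apply: U0; exists x.
right; apply/seteqP; split=> // x _.
have [t tU] := open_cylinder (ss_aligned S) oU Uz.
have [n [hn [g [l [rl sl]]]]] := cof (ks t) x (kd_s t).
pose a := bseg (lek0 n) hn.
have e : ks (kcomp t l) = act g (ks a) by rewrite ks_comp // sl bseg_s.
have dx : sgl_dom (sgl_single e) x.
  by exists (kcomp t l, g, a) => //; apply/ZsetE/starts_bseg.
(* Invariance is used backwards: the image [y] starts with [kcomp t l], hence lies in [U], and so
   does [x]. *)
have [y ty] := theta_graph_ex dx; apply/(inv _ _ _ ty)/tU.
move: ty => [? [? [? [? [w [[-> _ _] _ _ /concat_head]]]]]].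
by apply: starts_prefix; exists l.
Qed.

(** The rest of [b] after [a], moved by [g], prolongs [l]. *)
Lemma reach_extend v g a b : kprefix a b ->
  (exists l, kr l = v /\ ks l = act g (ks a)) ->
  exists l, kr l = v /\ ks l = act g (ks b).
Proof.
move=> [c ac ->] [l [rl sl]].
have lc : ks l = kr (act g c) by rewrite ssact_r -ac.
exists (kcomp l (act g c)); split; first by rewrite kr_comp.
by rewrite !ks_comp // ssact_s.
Qed.

Lemma irreducible_cofinal : theta_irreducible S -> G_cofinal S.
Proof.
move=> irr v x v0.
pose R a := exists g l, kr l = v /\ ks l = act g (ks a).
(* Phrased by initial segments instead of degrees, [U] is visibly a union of cylinders. *)
pose U := [set z | exists2 a, starts a z & R a].
have Ux : U x.
  have [||U0|->//] := irr U.
  - rewrite (_ : U = \bigcup_(a in R) [set z | starts a z]).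
      by apply: bigcup_open => a _; apply: open_starts.
    by apply/seteqP; split=> z [a]; exists a.
  - move=> F _ [z [[a sa Ra] Fz] <-].
    have [mu [g [nu [y [w [Ft c1 b c2]]]]]] := thetaP Fz.
    (* Lengthening [a] to a segment [kcomp nu d] keeps it reachable and lets the triple act on
       it. *)
    have [c [sc ac [d nd ec]]] := starts_join sa (concat_head c1).
    have [h [l Hl]] := Ra.
    have [l' [rl' sl']] := reach_extend ac (ex_intro _ l Hl).
    have sd : starts d y by apply/(concat_starts c1 nd); rewrite -ec.
    have sw := ((bactP g y w).1 b d).1 sd.
    exists (kcomp mu (act g d)).
      by apply/(concat_starts c2) => //; apply: act_vertex Ft nd.
    (* The factor [g^-1] cancels the [g] in the source g . s(d) of the new segment. *)
    exists (h * g^-1)%g, l'; split=> //.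
    rewrite ks_comp; last exact: act_vertex Ft nd.
    by rewrite ssact_s ssactM actK sl' ec ks_comp.
  - have [z sz] := boundary_path_ex v.
    have : U z by exists v => //; exists 1%g, v; rewrite ssact1 kd0_vertex.
    by rewrite U0.
have [a [ha ea] [g [l [rl sl]]]] := Ux.
by exists (kd a), ha, g, l; split=> //; rewrite sl -[in LHS]ea bseg_s.
Qed.

End Action.

Theorem theorem8p3 (k : nat) (L : kgraph k) (G : groupType)
    (S : self_similar L G) :
  (theta_irreducible S
     <-> groupoid_minimal (@germ_source k L G S) (@germ_range k L G S))
  /\ (groupoid_minimal (@germ_source k L G S) (@germ_range k L G S)
        <-> G_cofinal S).
Proof.
split; first exact: irreducible_minimal.
rewrite -irreducible_minimal.
by split; [apply: irreducible_cofinal | apply: cofinal_irreducible].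
Qed.
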